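(* Let $\rho\in C^\infty(\mathbb T)$ be nonnegative. Then $$\int_{\mathbb T}\rho^2\Lambda^3\rho\,ds\ge0,\qquad I_1:=\int_{\mathbb T}\rho(\Lambda\rho_s)\rho_s\,ds\ge0.$$ If, in addition, $\rho\ge\kappa>0$ for a constant $\kappa$, then $$I_1\ge\kappa\|\Lambda^{3/2}\rho\|_2^2.$$ Equality in $\int_{\mathbb T}\rho^2\Lambda^3\rho\,ds\ge0$ (equivalently $I_1=0$) holds if and only if $\rho$ is constant.
   Context: $\mathbb T=\mathbb R/2\pi\mathbb Z$, functions are real valued, and $\rho_s$ is the derivative of $\rho$. For $\alpha>0$, $\Lambda^\alpha$ is the Fourier multiplier $\widehat{\Lambda^\alpha f}(k)=|k|^\alpha\hat f(k)$. $\|\cdot\|_2$ is the $L^2(\mathbb T,ds)$ norm with unnormalized Lebesgue measure. One has $I_1=\frac12\int_{\mathbb T}\rho^2\Lambda^3\rho\,ds$. *)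

(* Defs.v *)
From mathcomp Require Import all_boot all_order all_algebra complex.
From mathcomp Require Import all_classical all_reals all_analysis.

Set Implicit Arguments.
Unset Strict Implicit.
Unset Printing Implicit Defensive.

Import Order.TTheory GRing.Theory Num.Theory.
Import numFieldNormedType.Exports.

Local Open Scope classical_set_scope.
Local Open Scope ring_scope.
Local Open Scope complex_scope.

(** Functions on the torus [R/2πZ] are represented by 2π-periodic functions
    on [R], and integration over the torus by Lebesgue integration over one
    period. *)
Section torus.
Context {R : realType}.
Implicit Types (f : R -> R) (g : R -> R[i]) (s : R) (k : int).

Definition smooth_torus f : Prop :=
  (forall s, f (s + 2 * pi) = f s) /\
  (forall (n : nat) s, derivable (derive1n n f) s 1).

Definition torus_int f : R :=
  \int[lebesgue_measure]_(s in `[0, 2 * pi]) f s.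

Definition torus_norm2 f : R := Num.sqrt (torus_int (fun s => f s ^+ 2)).

Definition torus_intC g : R[i] :=
  torus_int (fun s => complex.Re (g s)) +i*
  torus_int (fun s => complex.Im (g s)).

Definition expi s : R[i] := cos s +i* sin s.

Definition fourier f k : R[i] :=
  ((2 * pi)^-1)%:C * torus_intC (fun s => (f s)%:C * expi (- (k%:~R * s))).

Definition Lambda_mode (a : R) f s k : R[i] :=
  (`|k%:~R| `^ a)%:C * fourier f k * expi (k%:~R * s).

(** The multiplier is given by its Fourier series, summed over [-N <= k <= N]
    with [k = i - N]. Since [f] is real valued and [|k|^a] is even in [k], the
    symmetric partial sums are real, so taking real parts loses nothing. For
    [a > 0] the mode [k = 0] is killed, as [0 `^ a = 0]. *)
Definition Lambda_partial (a : R) f s (N : nat) : R[i] :=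
  \sum_(i < N.*2.+1) Lambda_mode a f s (i%:Z - N%:Z).

Definition Lambda (a : R) f s : R :=
  limn (fun N => complex.Re (Lambda_partial a f s N)).

Definition I1 f : R := torus_int (fun s => f s * Lambda 1 (derive1 f) s * derive1 f s).

End torus.

(* Main.v *)
Require Import Defs.
From mathcomp Require Import all_boot all_order all_algebra complex ring lra.
From mathcomp Require Import all_classical all_reals all_analysis measurable_realfun.

(** Let [e_k = c_k exp (iks)], [k >= 0], be the Fourier modes of [rho], with half
    of the mean in [e_0], so that [rho] is the sum of the [e_k + conj(e_k)]. The
    integral [X_ijk] of the real part of [e_i e_j conj(e_k)] vanishes unless
    [k = i + j], and it is symmetric in [i] and [j]. Expanding the products gives
    [[
      \int rho^2 Lambda^3 rho = 2 sum_(ijk) (i^3 + j^3 + k^3) X_ijk,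
      \int rho sum_(jk) b(j,k) e_j conj(e_k) = sum_(ijk) (b(j,k) + b(i,k)) X_ijk
    ]]
    for any real symmetric kernel [b]. The kernel [b(j,k) = 6 j^2 k - 2 j^3] for
    [j <= k] satisfies [b(j,k) + b(i,k) = 2 (i^3 + j^3 + k^3)] when [k = i + j],
    so the two integrals agree. This kernel is 12 times the integral of
    [(j - x) (k - x)] over [0 <= x <= min j k], the cubic spline kernel, which is
    positive semidefinite. Hence the first integral is the integral of [rho W],
    where [W >= 0] is an explicit sum of squared moduli ([spline_density],
    [spline_kernel_resonant], [torus_int_sqr_cube]).

    The identities are proved for trigonometric sums. The truncation of [rho] at
    frequency [N] need not be nonnegative, but its [W] has frequencies at most [N],
    so it may be integrated against [rho] instead; then [N] tends to infinity
    ([torus_int_cube_ge]). Keeping one square of [W] gives the quantitative bound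
    [torus_int_Lambda3_ge]: the integral of [rho^2 Lambda^3 rho] is at least a
    quarter of that of [rho (rho - a)^2], where [a] is the mean of [rho]. If it
    vanishes, [rho] takes only the values [0] and [a], hence is constant.

    The same expansion shows that [2 I1] is the integral of [rho^2 Lambda^3 rho]
    ([I1_eq]). When [rho >= kappa], the function [rho - kappa] is still nonnegative,
    and [I1 (rho - kappa)] is [I1 rho] minus [kappa] times the squared norm of
    [Lambda^(3/2) rho] ([I1_subr]), which is the third claim.

    The passage to the limit needs the Fourier series of [rho], its derivative and
    their images under powers of [Lambda] to converge uniformly. Integration by
    parts gives the decay of the coefficients. That the series of [rho] converges
    to [rho] is obtained by dividing [rho t - rho s] by [sin ((t - s) / 2)]: the
    quotient is bounded, and the error is a sum of Fourier coefficients of bounded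
    functions, which tend to 0 by Bessel's inequality ([fourier_inversion]). *)

Set Implicit Arguments.
Unset Strict Implicit.
Unset Printing Implicit Defensive.
Import Order.TTheory GRing.Theory Num.Theory.
Import numFieldNormedType.Exports.
Local Open Scope classical_set_scope.
Local Open Scope ring_scope.

(** * Integration of bounded measurable functions over the torus *)

Section bounded_measurable.
Context {R : realType}.
Implicit Types f g : R -> R.
Local Notation mu := (@lebesgue_measure R).

(** This class contains trigonometric polynomials, their uniform limits, and the
    possibly discontinuous quotient that appears in the proof of Fourier inversion. *)
Definition bmeas f := measurable_fun setT f /\ exists M : R, forall s, `|f s| <= M.

Lemma twopi_gt0 : 0 < 2 * pi :> R.
Proof. by rewrite mulr_gt0 ?pi_gt0. Qed.

Lemma bmeas_integrable f : bmeas f ->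
  mu.-integrable `[0, 2 * pi] (EFin \o f).
Proof.
move=> [mf [M fM]]; apply: measurable_bounded_integrable => //.
- by rewrite /= lebesgue_measure_itv/=; case: ifP => // _; rewrite -EFinD ltry.
- exact: measurable_funS mf.
- exists M; split; first by rewrite num_real.
  by move=> N MN x _ /=; rewrite (le_trans (fM x))// ltW.
Qed.

Lemma continuous_bmeas f M : continuous f -> (forall s, `|f s| <= M) -> bmeas f.
Proof. by move=> cf fM; split; [exact: continuous_measurable_fun|exists M]. Qed.

Lemma bmeas_cst c : bmeas (fun=> c).
Proof. by split; [exact: measurable_cst|exists `|c|]. Qed.

Lemma bmeasD f g : bmeas f -> bmeas g -> bmeas (fun s => f s + g s).
Proof.
move=> [mf [M fM]] [mg [N gN]]; split; first exact: measurable_funD.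
by exists (M + N) => s; rewrite (le_trans (ler_normD _ _))// lerD.
Qed.

Lemma bmeasM f g : bmeas f -> bmeas g -> bmeas (fun s => f s * g s).
Proof.
move=> [mf [M fM]] [mg [N gN]]; split; first exact: measurable_funM.
by exists (M * N) => s; rewrite normrM ler_pM.
Qed.

Lemma bmeasZ c f : bmeas f -> bmeas (fun s => c * f s).
Proof. by move=> bf; apply: bmeasM => //; exact: bmeas_cst. Qed.

Lemma bmeasB f g : bmeas f -> bmeas g -> bmeas (fun s => f s - g s).
Proof.
move=> bf bg; under eq_fun do rewrite -mulN1r.
by apply: bmeasD => //; exact: bmeasZ.
Qed.

Lemma bmeasX f n : bmeas f -> bmeas (fun s => f s ^+ n).
Proof.
move=> bf; elim: n => [|n IH]; first by under eq_fun do rewrite expr0; exact: bmeas_cst.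
by under eq_fun do rewrite exprS; exact: bmeasM.
Qed.

Lemma bmeas_sum (I : Type) (r : seq I) (F : I -> R -> R) :
  (forall i, bmeas (F i)) -> bmeas (fun s => \sum_(i <- r) F i s).
Proof.
move=> bF; elim: r => [|i r IH].
  by under eq_fun do rewrite big_nil; exact: bmeas_cst.
by under eq_fun do rewrite big_cons; exact: bmeasD.
Qed.

Lemma eq_torus_int f g : f =1 g -> torus_int f = torus_int g.
Proof. by move=> fg; congr torus_int; exact: funext. Qed.

Lemma torus_intD f g : bmeas f -> bmeas g ->
  torus_int (fun s => f s + g s) = torus_int f + torus_int g.
Proof. by move=> bf bg; rewrite /torus_int RintegralD//; exact: bmeas_integrable. Qed.

Lemma torus_intB f g : bmeas f -> bmeas g ->
  torus_int (fun s => f s - g s) = torus_int f - torus_int g.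
Proof. by move=> bf bg; rewrite /torus_int RintegralB//; exact: bmeas_integrable. Qed.

Lemma torus_intZ c f : bmeas f -> torus_int (fun s => c * f s) = c * torus_int f.
Proof. by move=> bf; rewrite /torus_int RintegralZl//; exact: bmeas_integrable. Qed.

Lemma torus_int_cst c : torus_int (fun=> c) = c * (2 * pi) :> R.
Proof.
rewrite /torus_int Rintegral_cst//= lebesgue_measure_itv/= lte_fin twopi_gt0.
by rewrite -EFinD/= subr0.
Qed.

Lemma torus_int_ge0 f : (forall s, 0 <= f s) -> 0 <= torus_int f.
Proof. by move=> f0; apply: Rintegral_ge0. Qed.

Lemma torus_int_sum (I : Type) (r : seq I) (F : I -> R -> R) :
  (forall i, bmeas (F i)) ->
  torus_int (fun s => \sum_(i <- r) F i s) = \sum_(i <- r) torus_int (F i).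
Proof.
move=> bF; elim: r => [|i r IH].
  rewrite big_nil; under eq_torus_int do rewrite big_nil.
  by rewrite torus_int_cst mul0r.
rewrite big_cons; under eq_torus_int do rewrite big_cons.
by rewrite torus_intD ?IH//; exact: bmeas_sum.
Qed.

Lemma le_torus_int f g : bmeas f -> bmeas g -> (forall s, f s <= g s) ->
  torus_int f <= torus_int g.
Proof. by move=> bf bg fg; apply: le_Rintegral => //; exact: bmeas_integrable. Qed.

Lemma torus_int_le_bound f M : bmeas f -> (forall s, `|f s| <= M) ->
  `|torus_int f| <= M * (2 * pi).
Proof.
move=> bf fM; rewrite ler_norml -mulNr -!torus_int_cst.
by apply/andP; split; apply: le_torus_int => //; try exact: bmeas_cst;
   move=> s; have := fM s; rewrite ler_norml => /andP[].
Qed.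

(** * Uniform convergence *)

Definition uconv (u : nat -> R -> R) f :=
  exists2 d : nat -> R, d @ \oo --> 0 & forall N s, `|u N s - f s| <= d N.

Lemma uconv_cst f : uconv (fun=> f) f.
Proof.
exists (fun=> 0); first exact: cvg_cst.
by move=> N s; rewrite subrr normr0.
Qed.

Lemma cvg_dist_le (x d : nat -> R) l : d @ \oo --> 0 ->
  (forall N, `|x N - l| <= d N) -> x @ \oo --> l.
Proof.
move=> d0 xd; apply/cvgrPdist_le => e e0; near=> N.
rewrite distrC (le_trans (xd N))// (le_trans (ler_norm _))//.
near: N; have /cvgrPdist_le/(_ e e0) := d0.
by apply: filterS => N /=; rewrite sub0r normrN.
Unshelve. all: by end_near. Qed.

Lemma uconv_cvg u f s : uconv u f -> u ^~ s @ \oo --> f s.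
Proof. move=> [d d0 ud]. apply: (cvg_dist_le d0) => N. exact: ud. Qed.

Lemma uconv_bmeas u f : (forall N, bmeas (u N)) -> uconv u f -> bmeas f.
Proof.
move=> bu uf; split.
  apply: (measurable_fun_cvg (h := u)) => [N|s _]; first by case: (bu N).
  exact: uconv_cvg.
have [_ [M uM]] := bu 0%N; have [d _ ud] := uf.
exists (M + d 0%N) => s; rewrite -[f s](subrK (u 0%N s)) addrC.
by rewrite (le_trans (ler_normD _ _))// lerD// distrC.
Qed.

Lemma uconvM u v f g : bmeas f -> bmeas g -> uconv u f -> uconv v g ->
  uconv (fun N s => u N s * v N s) (fun s => f s * g s).
Proof.
move=> [_ [A fA]] [_ [B gB]] [d d0 ud] [e e0 ve].
exists (fun N => d N * (B + e N) + A * e N).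
  rewrite -[X in _ --> X](_ : 0 * (B + 0) + A * 0 = 0); last by ring.
  apply: cvgD; last by apply: cvgM => //; exact: cvg_cst.
  by apply: cvgM => //; apply: cvgD => //; exact: cvg_cst.
move=> N s.
have -> : u N s * v N s - f s * g s = (u N s - f s) * v N s + f s * (v N s - g s).
  by ring.
rewrite (le_trans (ler_normD _ _))// !normrM lerD// ler_pM//.
by rewrite -[v N s](subrK (g s)) addrC (le_trans (ler_normD _ _))// lerD.
Qed.

Lemma uconv_torus_int u f : (forall N, bmeas (u N)) -> uconv u f ->
  torus_int (u N) @[N --> \oo] --> torus_int f.
Proof.
move=> bu uf; have bf := uconv_bmeas bu uf; have [d d0 ud] := uf.
apply: (@cvg_dist_le _ (fun N => d N * (2 * pi))) => [|N].
  by rewrite -[X in _ --> X](mul0r (2 * pi)); apply: cvgM => //; exact: cvg_cst.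
rewrite -torus_intB//; apply: torus_int_le_bound => //; exact: bmeasB.
Qed.

End bounded_measurable.

(** * Pure harmonics and their integrals *)

Section harmonics.
Context {R : realType}.
Implicit Types (f g P Q F : R -> R) (m n : int).

Definition periodic_torus f := forall s, f (s + 2 * pi) = f s.

(** The fundamental theorem of calculus over one period. *)
Lemma torus_int_derive F f : (forall s, is_derive s (1 : R) F (f s)) -> continuous f ->
  periodic_torus F -> torus_int f = 0.
Proof.
move=> dF cf pF.
have cF : continuous F.
  move=> s; apply: differentiable_continuous.
  by apply/derivable1_diffP; case: (dF s).
rewrite /torus_int /Rintegral (@continuous_FTC2 _ f F) ?twopi_gt0//=.
- by rewrite -[X in F X]add0r pF subrr.
- exact: continuous_subspaceT.
- split; first by move=> s _; case: (dF s).
  + apply: cvg_at_right_filter; exact: cF.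
  + apply: cvg_at_left_filter; exact: cF.
- by move=> s _; rewrite derive1E; exact: derive_val.
Qed.

Lemma continuous_cosM (a : R) : continuous (fun s : R => cos (a * s)).
Proof.
move=> s; apply: (@continuous_comp _ _ _ ( *%R a) cos); first exact: mulrl_continuous.
exact: continuous_cos.
Qed.

Lemma continuous_sinM (a : R) : continuous (fun s : R => sin (a * s)).
Proof.
move=> s; apply: (@continuous_comp _ _ _ ( *%R a) sin); first exact: mulrl_continuous.
exact: continuous_sin.
Qed.

Lemma bmeas_cosM (a : R) : bmeas (fun s => cos (a * s)).
Proof.
by apply: (@continuous_bmeas _ _ 1) => [|s]; [exact: continuous_cosM|exact: cos_max].
Qed.

Lemma bmeas_sinM (a : R) : bmeas (fun s => sin (a * s)).
Proof.
by apply: (@continuous_bmeas _ _ 1) => [|s]; [exact: continuous_sinM|exact: sin_max].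
Qed.

Lemma periodic_int f m s : periodic_torus f -> f (s + m%:~R * (2 * pi)) = f s.
Proof.
move=> pf; have nat_case (k : nat) t : f (t + k%:R * (2 * pi)) = f t.
  elim: k t => [|k IH] t; first by rewrite mul0r addr0.
  by rewrite -natr1 mulrDl mul1r addrA pf IH.
case: m => n; first exact: nat_case.
by rewrite NegzE mulrNz -(nat_case n.+1 (s + _)) mulNr subrK.
Qed.

Lemma cos_intM m (s : R) : cos (m%:~R * (s + 2 * pi)) = cos (m%:~R * s).
Proof.
rewrite mulrDr (periodic_int (f := cos)) // => t.
by rewrite mulr_natl cosD2pi.
Qed.

Lemma sin_intM m (s : R) : sin (m%:~R * (s + 2 * pi)) = sin (m%:~R * s).
Proof.
rewrite mulrDr (periodic_int (f := sin)) // => t.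
by rewrite mulr_natl sinD2pi.
Qed.

(** [P + iQ] is a constant multiple of [exp (ims)]: complex exponentials are
    handled through their real and imaginary parts, so that only real integrals
    occur. *)
Definition harmonic_pair m P Q := exists a b, forall s,
  P s = a * cos (m%:~R * s) - b * sin (m%:~R * s) /\
  Q s = a * sin (m%:~R * s) + b * cos (m%:~R * s).

Lemma harmonic_pairM m n P Q P' Q' : harmonic_pair m P Q -> harmonic_pair n P' Q' ->
  harmonic_pair (m + n) (fun s => P s * P' s - Q s * Q' s)
                        (fun s => P s * Q' s + Q s * P' s).
Proof.
move=> [a [b h]] [a' [b' h']]; exists (a * a' - b * b'), (a * b' + b * a') => s.
have [-> ->] := h s; have [-> ->] := h' s; rewrite /=.
by rewrite intrD [(_ + _) * s]mulrDl cosD sinD; split; ring.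
Qed.

Lemma harmonic_pairJ m P Q : harmonic_pair m P Q ->
  harmonic_pair (- m) P (fun s => - Q s).
Proof.
move=> [a [b h]]; exists a, (- b) => s; have [-> ->] := h s.
by rewrite mulrNz mulNr cosN sinN; split; ring.
Qed.

Lemma is_derive_cosM (a s : R) :
  is_derive s (1 : R) (fun t => cos (a * t)) (- a * sin (a * s)).
Proof.
have da : is_derive s (1 : R) ( *%R a) a.
  by rewrite -[X in is_derive _ _ _ X]mulr1 -[X in _ * X]/(1 : R); exact: is_deriveZ.
have := @is_derive1_comp _ cos ( *%R a) s _ _ (is_derive_cos _) da.
by rewrite mulrC mulrN mulNr.
Qed.

Lemma is_derive_sinM (a s : R) :
  is_derive s (1 : R) (fun t => sin (a * t)) (a * cos (a * s)).
Proof.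
have da : is_derive s (1 : R) ( *%R a) a.
  by rewrite -[X in is_derive _ _ _ X]mulr1 -[X in _ * X]/(1 : R); exact: is_deriveZ.
have := @is_derive1_comp _ sin ( *%R a) s _ _ (is_derive_sin _) da.
by rewrite mulrC.
Qed.

Lemma torus_int_cosM m : m != 0 -> torus_int (fun s => cos (m%:~R * s)) = 0 :> R.
Proof.
move=> m0; have mR0 : m%:~R != 0 :> R by rewrite intr_eq0.
apply: (@torus_int_derive (fun s => m%:~R^-1 * sin (m%:~R * s))).
- move=> s; rewrite -[X in is_derive _ _ _ X](mulKf mR0).
  by apply: is_deriveZ; exact: is_derive_sinM.
- exact: continuous_cosM.
- by move=> s; rewrite sin_intM.
Qed.

Lemma torus_int_sinM m : torus_int (fun s => sin (m%:~R * s)) = 0 :> R.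
Proof.
have [->|m0] := eqVneq m 0.
  by under eq_torus_int do rewrite mul0r sin0; rewrite torus_int_cst mul0r.
have mR0 : m%:~R != 0 :> R by rewrite intr_eq0.
apply: (@torus_int_derive (fun s => - m%:~R^-1 * cos (m%:~R * s))).
- move=> s; rewrite -[X in is_derive _ _ _ X](mulKf mR0) -[X in is_derive _ _ _ X]mulrNN.
  by apply: is_deriveZ; rewrite -mulNr; exact: is_derive_cosM.
- exact: continuous_sinM.
- by move=> s; rewrite cos_intM.
Qed.

(** Only the zero frequency contributes to an integral over the torus; all
    orthogonality relations below come from this. *)
Lemma torus_int_harmonic m P Q : harmonic_pair m P Q -> m != 0 -> torus_int P = 0.
Proof.
move=> [a [b h]] m0; under eq_torus_int do rewrite (h _).1.
have bc := bmeas_cosM m%:~R; have bs := bmeas_sinM m%:~R.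
rewrite torus_intB; [|exact: bmeasZ|exact: bmeasZ].
by rewrite !torus_intZ// torus_int_cosM// torus_int_sinM !mulr0 subrr.
Qed.

End harmonics.

(** * Triple sums *)

Section triple_sums.
Context {R : realType}.

Lemma big_distr3 (l m n : nat) (a b c : nat -> R) :
  (\sum_(i < l) a i) * (\sum_(j < m) b j) * (\sum_(k < n) c k) =
  \sum_(i < l) \sum_(j < m) \sum_(k < n) a i * b j * c k.
Proof.
rewrite big_distrlr /= mulr_suml; apply: eq_bigr => i _.
by rewrite mulr_suml; apply: eq_bigr => j _; rewrite mulr_sumr.
Qed.

Lemma torus_int_sum3 (l m n : nat) (w : 'I_l -> 'I_m -> 'I_n -> R)
    (F : 'I_l -> 'I_m -> 'I_n -> R -> R) : (forall i j k, bmeas (F i j k)) ->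
  torus_int (fun s => \sum_(i < l) \sum_(j < m) \sum_(k < n) w i j k * F i j k s) =
  \sum_(i < l) \sum_(j < m) \sum_(k < n) w i j k * torus_int (F i j k).
Proof.
move=> bF; have bwF i j k : bmeas (fun s => w i j k * F i j k s) by exact: bmeasZ.
rewrite torus_int_sum => [|i]; last by do 2 apply: bmeas_sum => ?.
apply: eq_bigr => i _; rewrite torus_int_sum => [|j]; last exact: bmeas_sum.
apply: eq_bigr => j _; rewrite torus_int_sum//.
by apply: eq_bigr => k _; rewrite torus_intZ.
Qed.

Lemma sum3D (l m n : nat) (F G : 'I_l -> 'I_m -> 'I_n -> R) :
  \sum_(i < l) \sum_(j < m) \sum_(k < n) (F i j k + G i j k) =
  \sum_(i < l) \sum_(j < m) \sum_(k < n) F i j k +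
  \sum_(i < l) \sum_(j < m) \sum_(k < n) G i j k.
Proof.
rewrite -big_split; apply: eq_bigr => i _; rewrite -big_split.
by apply: eq_bigr => j _; rewrite -big_split.
Qed.

Lemma sum3Z (l m n : nat) c (F : 'I_l -> 'I_m -> 'I_n -> R) :
  \sum_(i < l) \sum_(j < m) \sum_(k < n) c * F i j k =
  c * \sum_(i < l) \sum_(j < m) \sum_(k < n) F i j k.
Proof.
rewrite mulr_sumr; apply: eq_bigr => i _; rewrite mulr_sumr.
by apply: eq_bigr => j _; rewrite mulr_sumr.
Qed.

Lemma eq_sum3 (l m n : nat) (F G : 'I_l -> 'I_m -> 'I_n -> R) :
  (forall i j k, F i j k = G i j k) ->
  \sum_(i < l) \sum_(j < m) \sum_(k < n) F i j k =
  \sum_(i < l) \sum_(j < m) \sum_(k < n) G i j k.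
Proof. by move=> FG; do 3 apply: eq_bigr => ? _; exact: FG. Qed.

Lemma sum3_swap23 (n : nat) (F : 'I_n -> 'I_n -> 'I_n -> R) :
  \sum_(i < n) \sum_(j < n) \sum_(k < n) F i j k =
  \sum_(i < n) \sum_(j < n) \sum_(k < n) F i k j.
Proof. by apply: eq_bigr => i _; exact: exchange_big. Qed.

Lemma sum3_swap12 (n : nat) (F : 'I_n -> 'I_n -> 'I_n -> R) :
  \sum_(i < n) \sum_(j < n) \sum_(k < n) F i j k =
  \sum_(i < n) \sum_(j < n) \sum_(k < n) F j i k.
Proof. exact: exchange_big. Qed.

Lemma sum3_rot (n : nat) (F : 'I_n -> 'I_n -> 'I_n -> R) :
  \sum_(i < n) \sum_(j < n) \sum_(k < n) F i j k =
  \sum_(i < n) \sum_(j < n) \sum_(k < n) F k i j.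
Proof. by rewrite sum3_swap12 (sum3_swap23 (fun i j k => F j i k)). Qed.

Lemma sum3_perm (n : nat) (F G H : 'I_n -> 'I_n -> 'I_n -> R) :
  \sum_(i < n) \sum_(j < n) \sum_(k < n) (F i j k + G i k j + H j k i) =
  \sum_(i < n) \sum_(j < n) \sum_(k < n) (F i j k + G i j k + H i j k).
Proof.
rewrite (sum3D (fun i j k => F i j k + G i k j) (fun i j k => H j k i)).
rewrite (sum3D F (fun i j k => G i k j)).
rewrite (sum3D (fun i j k => F i j k + G i j k) H) (sum3D F G).
by rewrite -(sum3_swap23 G) (sum3_rot (fun i j k => H j k i)).
Qed.

End triple_sums.

(** * Resonant triples and trilinear integrals *)

Section modes.
Context {R : realType}.
Variables x y : nat -> R.
Implicit Types (s : R) (w : nat -> R).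

(** [modeP k + i modeQ k] is the mode [e_k = (x k + i y k) exp (iks)]. *)
Definition modeP k s := x k * cos (k%:R * s) - y k * sin (k%:R * s).
Definition modeQ k s := x k * sin (k%:R * s) + y k * cos (k%:R * s).

Lemma bmeas_modeP k : bmeas (modeP k).
Proof. by apply: bmeasB; apply: bmeasZ; [exact: bmeas_cosM|exact: bmeas_sinM]. Qed.

Lemma bmeas_modeQ k : bmeas (modeQ k).
Proof. by apply: bmeasD; apply: bmeasZ; [exact: bmeas_sinM|exact: bmeas_cosM]. Qed.

Lemma harmonic_pair_mode k : harmonic_pair k%:Z (modeP k) (modeQ k).
Proof. by exists (x k), (y k). Qed.

(** [trigP w N] and [trigQ w N] are twice the real and imaginary parts of the sum
    of [w k * e_k] over [k <= N]. With weights 1, the first is the function itself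
    truncated at frequency [N], provided that [x 0] is half of its mean: the mode
    of frequency 0 is then treated like the others. *)
Definition trigP w N s := \sum_(k < N.+1) w k * (2 * modeP k s).
Definition trigQ w N s := \sum_(k < N.+1) w k * (2 * modeQ k s).

Lemma bmeas_trigP w N : bmeas (trigP w N).
Proof. by apply: bmeas_sum => k; do 2 apply: bmeasZ; exact: bmeas_modeP. Qed.

Lemma bmeas_trigQ w N : bmeas (trigQ w N).
Proof. by apply: bmeas_sum => k; do 2 apply: bmeasZ; exact: bmeas_modeQ. Qed.

(** Real part of [e_i e_j conj(e_k)]. *)
Definition triple i j k s :=
  (modeP i s * modeP j s - modeQ i s * modeQ j s) * modeP k s +
  (modeP i s * modeQ j s + modeQ i s * modeP j s) * modeQ k s.

(** Real part of [e_i e_j e_k]. *)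
Definition triple_sum i j k s :=
  (modeP i s * modeP j s - modeQ i s * modeQ j s) * modeP k s -
  (modeP i s * modeQ j s + modeQ i s * modeP j s) * modeQ k s.

Definition trip i j k := torus_int (triple i j k).

Lemma bmeas_PQ k l : [/\ bmeas (fun s => modeP k s * modeP l s),
  bmeas (fun s => modeQ k s * modeQ l s), bmeas (fun s => modeP k s * modeQ l s)
  & bmeas (fun s => modeQ k s * modeP l s)].
Proof. by split; apply: bmeasM; (exact: bmeas_modeP || exact: bmeas_modeQ). Qed.

Lemma bmeas_triple i j k : bmeas (triple i j k).
Proof.
have [? ? ? ?] := bmeas_PQ i j; have ? := bmeas_modeP k; have ? := bmeas_modeQ k.
by apply: bmeasD; apply: bmeasM => //; [exact: bmeasB|exact: bmeasD].
Qed.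

Lemma bmeas_triple_sum i j k : bmeas (triple_sum i j k).
Proof.
have [? ? ? ?] := bmeas_PQ i j; have ? := bmeas_modeP k; have ? := bmeas_modeQ k.
by apply: bmeasB; apply: bmeasM => //; [exact: bmeasB|exact: bmeasD].
Qed.

Lemma harmonic_pair_mode2 i j : harmonic_pair (i + j)%:Z
  (fun s => modeP i s * modeP j s - modeQ i s * modeQ j s)
  (fun s => modeP i s * modeQ j s + modeQ i s * modeP j s).
Proof. by rewrite PoszD; apply: harmonic_pairM; exact: harmonic_pair_mode. Qed.

(** The integrand is a harmonic of frequency [i + j - k]. *)
Lemma trip_eq0 i j k : (i + j != k)%N -> trip i j k = 0.
Proof.
move=> ijk.
have h := harmonic_pairM (harmonic_pair_mode2 i j)
  (harmonic_pairJ (harmonic_pair_mode k)).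
rewrite -(torus_int_harmonic h) ?subr_eq0 ?eqz_nat//.
by apply: eq_torus_int => s; rewrite /triple mulrN opprK.
Qed.

(** The integrand is a harmonic of frequency [i + j + k]. *)
Lemma torus_int_triple_sum_eq0 i j k : (i + j + k != 0)%N ->
  torus_int (triple_sum i j k) = 0.
Proof.
move=> ijk.
have h := harmonic_pairM (harmonic_pair_mode2 i j) (harmonic_pair_mode k).
exact: (torus_int_harmonic h).
Qed.

Lemma tripC i j k : trip i j k = trip j i k.
Proof. by apply: eq_torus_int => s; rewrite /triple; ring. Qed.

(** As [trip i j k] is symmetric in [i, j] and supported on [k = i + j], a
    trilinear sum depends on its weights only through their symmetrization there. *)
Lemma sum_trip_eq N (w w' : nat -> nat -> nat -> R) :
  (forall i j, (i + j < N)%N ->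
     w i j (i + j)%N + w j i (i + j)%N = w' i j (i + j)%N + w' j i (i + j)%N) ->
  \sum_(i < N) \sum_(j < N) \sum_(k < N) w i j k * trip i j k =
  \sum_(i < N) \sum_(j < N) \sum_(k < N) w' i j k * trip i j k.
Proof.
move=> ww'; pose S (v : nat -> nat -> nat -> R) :=
  \sum_(i < N) \sum_(j < N) \sum_(k < N) v i j k * trip i j k.
have double v : S v + S v = S (fun i j k => v i j k + v j i k).
  rewrite {2}/S (sum3_swap12 (fun i j k => v i j k * trip i j k)).
  rewrite /S -[LHS](sum3D (fun i j k => v i j k * trip i j k)
    (fun i j k => v j i k * trip j i k)).
  by apply: eq_sum3 => i j k; rewrite [trip j i k]tripC -mulrDl.
suff : S w + S w = S w' + S w' by rewrite -/(S w) -/(S w'); lra.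
rewrite !double; apply: eq_sum3 => i j k.
have [ijk|ijk] := eqVneq (i + j)%N k; last by rewrite trip_eq0// !mulr0.
by rewrite -ijk ww'// ijk ltn_ord.
Qed.

(** In [2 P_i 2 P_j 2 P_k], the eight products of modes and conjugate modes group
    into twice the real parts of the three resonant types and of [e_i e_j e_k]. The
    last has zero integral unless [i = j = k = 0], where the weight vanishes; the
    first three are brought to [trip i j k] by permuting the indices. *)
Lemma torus_int_PPP N w : w 0%N = 0 ->
  torus_int (fun s => trigP (fun=> 1) N s ^+ 2 * trigP w N s) =
  2 * \sum_(i < N.+1) \sum_(j < N.+1) \sum_(k < N.+1) (w k + 2 * w j) * trip i j k.
Proof.
move=> w0; rewrite (@eq_torus_int _ _ (fun s => \sum_(i < N.+1) \sum_(j < N.+1)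
    \sum_(k < N.+1) (2 * w k) * (triple i j k s + triple i k j s + triple j k i s
      + triple_sum i j k s))); last first.
  move=> s; rewrite expr2 /trigP (big_distr3 _ _ _ (fun i => 1 * (2 * modeP i s))
    (fun i => 1 * (2 * modeP i s)) (fun i => w i * (2 * modeP i s))).
  apply: eq_sum3 => i j k.
  by rewrite /triple /triple_sum; ring.
have bt := bmeas_triple; have bts := bmeas_triple_sum.
rewrite torus_int_sum3 => [|i j k]; last first.
  by apply: bmeasD => //; apply: bmeasD => //; exact: bmeasD.
transitivity (\sum_(i < N.+1) \sum_(j < N.+1) \sum_(k < N.+1)
   (2 * w k * trip i j k + 2 * w k * trip i k j + 2 * w k * trip j k i)).
  apply: eq_sum3 => i j k.
  rewrite torus_intD//; last by apply: bmeasD => //; exact: bmeasD.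
  rewrite torus_intD//; last exact: bmeasD.
  rewrite torus_intD// !mulrDr; have [->|k0] := eqVneq (k : nat) 0%N.
    by rewrite w0 mulr0 !mul0r !addr0.
  by rewrite torus_int_triple_sum_eq0 ?mulr0 ?addr0// addn_eq0 negb_and k0 orbT.
rewrite (sum3_perm (fun i j k => 2 * w k * trip i j k)
  (fun i j k => 2 * w j * trip i j k) (fun i j k => 2 * w j * trip i j k)).
rewrite -(sum3Z _ (fun i j k => (w k + 2 * w j) * trip i j k)).
by apply: eq_sum3 => i j k; ring.
Qed.

(** The same computation, with the signs coming from two imaginary parts. *)
Lemma torus_int_PQQ N w w' : w 0%N = 0 ->
  torus_int (fun s => trigP (fun=> 1) N s * trigQ w N s * trigQ w' N s) =
  2 * \sum_(i < N.+1) \sum_(j < N.+1) \sum_(k < N.+1)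
     (w j * w' k + w k * w' j - w i * w' j) * trip i j k.
Proof.
move=> w0; rewrite (@eq_torus_int _ _ (fun s => \sum_(i < N.+1) \sum_(j < N.+1)
    \sum_(k < N.+1) (2 * w j * w' k) * (triple i j k s + triple i k j s - triple j k i s
      - triple_sum i j k s))); last first.
  move=> s; rewrite /trigP /trigQ (big_distr3 _ _ _ (fun i => 1 * (2 * modeP i s))
    (fun i => w i * (2 * modeQ i s)) (fun i => w' i * (2 * modeQ i s))).
  apply: eq_sum3 => i j k.
  by rewrite /triple /triple_sum; ring.
have bt := bmeas_triple; have bts := bmeas_triple_sum.
rewrite torus_int_sum3 => [|i j k]; last by do 2 apply: bmeasB => //; exact: bmeasD.
transitivity (\sum_(i < N.+1) \sum_(j < N.+1) \sum_(k < N.+1)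
   (2 * w j * w' k * trip i j k + 2 * w j * w' k * trip i k j
     + - (2 * w j * w' k * trip j k i))).
  apply: eq_sum3 => i j k.
  rewrite torus_intB//; last by apply: bmeasB => //; exact: bmeasD.
  rewrite torus_intB//; last exact: bmeasD.
  rewrite torus_intD// !mulrBr !mulrDr; have [->|j0] := eqVneq (j : nat) 0%N.
    by rewrite w0 mulr0 !mul0r !subr0.
  by rewrite torus_int_triple_sum_eq0 ?mulr0 ?subr0// !addn_eq0 !negb_and j0 orbT.
rewrite (sum3_perm (fun i j k => 2 * w j * w' k * trip i j k)
  (fun i j k => 2 * w k * w' j * trip i j k)
  (fun i j k => - (2 * w i * w' j * trip i j k))).
rewrite -(sum3Z _ (fun i j k => (w j * w' k + w k * w' j - w i * w' j) * trip i j k)).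
by apply: eq_sum3 => i j k; ring.
Qed.

End modes.

(** * The cubic spline kernel *)

Section positivity.
Context {R : realType}.
Variables x y : nat -> R.
Implicit Types (s : R) (w : nat -> R) (c : nat -> R).
Local Notation modeP := (modeP x y).
Local Notation modeQ := (modeQ x y).
Local Notation trigP := (trigP x y).
Local Notation trigQ := (trigQ x y).
Local Notation trip := (trip x y).

Lemma torus_int_QQ j k : (j + k != 0)%N ->
  torus_int (fun s => modeQ j s * modeQ k s) = torus_int (fun s => modeP j s * modeP k s).
Proof.
move=> jk; have [bP bQ _ _] := bmeas_PQ x y j k.
apply/esym/eqP; rewrite -subr_eq0 -torus_intB//; apply/eqP.
exact: (torus_int_harmonic (harmonic_pair_mode2 x y j k)).
Qed.

Lemma torus_int_PP_eq0 j k : (j != k)%N ->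
  torus_int (fun s => modeP j s * modeP k s) = 0.
Proof.
move=> jk; have [bP bQ _ _] := bmeas_PQ x y j k.
have h := harmonic_pairM (harmonic_pair_mode x y j)
  (harmonic_pairJ (harmonic_pair_mode x y k)).
have : torus_int (fun s => modeP j s * modeP k s + modeQ j s * modeQ k s) = 0.
  rewrite -(torus_int_harmonic h) ?subr_eq0 ?eqz_nat//.
  by apply: eq_torus_int => s; rewrite mulrN opprK.
rewrite torus_intD// torus_int_QQ; first lra.
by apply: contra jk; rewrite addn_eq0 => /andP[/eqP-> /eqP->].
Qed.

(** Parseval: off the diagonal both sides vanish, and real and imaginary parts of
    a mode of nonzero frequency have the same mean square. *)
Lemma torus_int_QQ_sqr N w w' v : w 0%N = 0 -> (forall k, w k * w' k = v k ^+ 2) ->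
  torus_int (fun s => trigQ w N s * trigQ w' N s) = torus_int (fun s => trigP v N s ^+ 2).
Proof.
move=> w0 ww'; have v0 : v 0%N = 0.
  by apply/eqP; have := ww' 0%N; rewrite w0 mul0r => /esym/eqP; rewrite sqrf_eq0.
have bPP j k : bmeas (fun s => modeP j s * modeP k s) by have [] := bmeas_PQ x y j k.
have bQQ j k : bmeas (fun s => modeQ j s * modeQ k s) by have [] := bmeas_PQ x y j k.
transitivity (\sum_(j < N.+1) \sum_(k < N.+1)
    4 * (w j * w' k) * torus_int (fun s => modeQ j s * modeQ k s)).
  under eq_torus_int do rewrite big_distrlr/=.
  rewrite torus_int_sum => [|j]; last first.
    by apply: bmeas_sum => k; apply: bmeasM; do 2 apply: bmeasZ; exact: bmeas_modeQ.
  apply: eq_bigr => j _; rewrite torus_int_sum => [|k]; last first.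
    by apply: bmeasM; do 2 apply: bmeasZ; exact: bmeas_modeQ.
  apply: eq_bigr => k _; rewrite -torus_intZ//; apply: eq_torus_int => s; ring.
transitivity (\sum_(j < N.+1) \sum_(k < N.+1)
    4 * (v j * v k) * torus_int (fun s => modeP j s * modeP k s)); last first.
  under [RHS]eq_torus_int do rewrite expr2 big_distrlr/=.
  rewrite torus_int_sum => [|j]; last first.
    by apply: bmeas_sum => k; apply: bmeasM; do 2 apply: bmeasZ; exact: bmeas_modeP.
  apply: eq_bigr => j _; rewrite torus_int_sum => [|k]; last first.
    by apply: bmeasM; do 2 apply: bmeasZ; exact: bmeas_modeP.
  apply: eq_bigr => k _; rewrite -torus_intZ//; apply: eq_torus_int => s; ring.
apply: eq_bigr => j _; apply: eq_bigr => k _.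
have [j0|j0] := eqVneq (j : nat) 0%N; first by rewrite j0 w0 v0 !(mul0r, mulr0).
rewrite torus_int_QQ; last by rewrite addn_eq0 negb_and j0.
have [jk|jk] := eqVneq (j : nat) k; first by rewrite jk ww' expr2.
by rewrite torus_int_PP_eq0// !mulr0.
Qed.

(** Squared modulus of the sum of [c k * e_k]. *)
Definition mode_sqnorm c N s :=
  (\sum_(k < N.+1) c k * modeP k s) ^+ 2 + (\sum_(k < N.+1) c k * modeQ k s) ^+ 2.

(** Since the mean of [(j - x) (k - x)] over [x] in [[n, n + 1]] is
    [(j - n - 1/2) (k - n - 1/2) + 1/12], the integral over that interval of
    [12 |sum_(k > x) (k - x) e_k| ^ 2] is [3 |sum_(k > n) (2 k - 2 n - 1) e_k| ^ 2
    + |sum_(k > n) e_k| ^ 2]. These are the two weights that occur in it. *)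
Definition tail_cut (n k : nat) : R := (n < k)%N%:R.
Definition tail_slope (n k : nat) : R := (n < k)%N%:R * (2 * k%:R - 2 * n%:R - 1).

Definition spline_density N s :=
  \sum_(n < N.+1) (3 * mode_sqnorm (tail_slope n) N s + mode_sqnorm (tail_cut n) N s).

(** The values at integers of [12 \int_0^(min j k) (j - x) (k - x) dx], the
    reproducing kernel of cubic splines, for [min j k <= N], written as a sum of rank one kernels. *)
Definition spline_kernel (N j k : nat) : R :=
  \sum_(n < N.+1) (3 * (tail_slope n j * tail_slope n k) + tail_cut n j * tail_cut n k).

Lemma spline_kernelC N j k : spline_kernel N j k = spline_kernel N k j.
Proof. by apply: eq_bigr => n _; ring. Qed.

Lemma spline_kernelE N j k : (j <= k)%N -> (j <= N)%N ->
  spline_kernel N j k = 6 * j%:R ^+ 2 * k%:R - 2 * j%:R ^+ 3.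
Proof.
move=> jk jN.
have sumE m : (m <= j)%N -> \sum_(n < m) (3 * (tail_slope n j * tail_slope n k) +
    tail_cut n j * tail_cut n k) =
    12 * j%:R * k%:R * m%:R - 6 * (j%:R + k%:R) * m%:R ^+ 2 + 4 * m%:R ^+ 3.
  elim: m => [|m IH] mj; first by rewrite big_ord0; ring.
  rewrite big_ord_recr IH ?(ltnW mj)//= /tail_slope /tail_cut mj (leq_trans mj jk).
  by rewrite /= -natr1; ring.
rewrite /spline_kernel -(subnKC (leqW jN)) big_split_ord/= sumE// big1 ?addr0.
  by ring.
by move=> n _; rewrite /tail_slope /tail_cut ltnNge leq_addr /=; ring.
Qed.

(** The reason for the choice of this kernel: on resonant triples it symmetrizes to
    the symbol of the trilinear form of [rho ^ 2 Lambda^3 rho]. *)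
Lemma spline_kernel_resonant N i j : (i + j <= N)%N ->
  spline_kernel N i (i + j) + spline_kernel N j (i + j) =
  2 * (i%:R ^+ 3 + j%:R ^+ 3 + (i + j)%:R ^+ 3).
Proof.
move=> ijN; rewrite !spline_kernelE ?leq_addr ?leq_addl//.
- by rewrite natrD; ring.
- exact: leq_trans (leq_addl _ _) ijN.
- exact: leq_trans (leq_addr _ _) ijN.
Qed.

Lemma mode_sqnormE c N s : mode_sqnorm c N s = \sum_(j < N.+1) \sum_(k < N.+1)
  c j * c k * (modeP j s * modeP k s + modeQ j s * modeQ k s).
Proof.
rewrite /mode_sqnorm !expr2 !big_distrlr -big_split; apply: eq_bigr => j _ /=.
by rewrite -big_split; apply: eq_bigr => k _ /=; ring.
Qed.

Lemma spline_densityE N s : spline_density N s = \sum_(j < N.+1) \sum_(k < N.+1)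
  spline_kernel N j k * (modeP j s * modeP k s + modeQ j s * modeQ k s).
Proof.
transitivity (\sum_(n < N.+1) \sum_(j < N.+1) \sum_(k < N.+1)
  (3 * (tail_slope n j * tail_slope n k) + tail_cut n j * tail_cut n k) *
  (modeP j s * modeP k s + modeQ j s * modeQ k s)).
  apply: eq_bigr => n _; rewrite !mode_sqnormE mulr_sumr -big_split.
  apply: eq_bigr => j _; rewrite /= mulr_sumr -big_split.
  by apply: eq_bigr => k _ /=; ring.
rewrite exchange_big; apply: eq_bigr => j _; rewrite exchange_big.
by apply: eq_bigr => k _; rewrite /spline_kernel -mulr_suml.
Qed.

Lemma bmeas_mode_sqnorm c N : bmeas (mode_sqnorm c N).
Proof.
by apply: bmeasD; apply: bmeasX; apply: bmeas_sum => k; apply: bmeasZ;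
  [exact: bmeas_modeP|exact: bmeas_modeQ].
Qed.

Lemma bmeas_spline_density N : bmeas (spline_density N).
Proof.
by apply: bmeas_sum => n; apply: bmeasD; [apply: bmeasZ|]; exact: bmeas_mode_sqnorm.
Qed.

(** The density has frequencies at most [N], hence does not see the modes of the
    first factor beyond [N]. *)
Lemma torus_int_spline_density M N : (N <= M)%N ->
  torus_int (fun s => trigP (fun=> 1) M s * spline_density N s) =
  2 * \sum_(i < N.+1) \sum_(j < N.+1) \sum_(k < N.+1) spline_kernel N j k * trip i j k.
Proof.
move=> NM; rewrite (@eq_torus_int _ _ (fun s => \sum_(i < M.+1) \sum_(j < N.+1)
    \sum_(k < N.+1) spline_kernel N j k *
      (triple x y i j k s + triple x y i k j s))); last first.
  move=> s; rewrite spline_densityE mulr_suml; apply: eq_bigr => i _.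
  rewrite mulr_sumr; apply: eq_bigr => j _; rewrite mulr_sumr.
  by apply: eq_bigr => k _; rewrite /triple; ring.
have bt := bmeas_triple x y.
rewrite torus_int_sum3 => [|i j k]; last exact: bmeasD.
transitivity (\sum_(i < N.+1) \sum_(j < N.+1) \sum_(k < N.+1)
    (spline_kernel N j k * trip i j k + spline_kernel N j k * trip i k j)).
  rewrite -(subnKC (_ : N.+1 <= M.+1)%N)// big_split_ord/= [X in _ + X]big1 ?addr0.
    by apply: eq_sum3 => i j k; rewrite torus_intD// mulrDr.
  move=> i _; rewrite big1// => j _; rewrite big1// => k _.
  rewrite torus_intD// -!/(trip _ _ _) !trip_eq0 ?addr0 ?mulr0//.
  - by rewrite gtn_eqF// (leq_trans (ltn_ord _))// -addnA leq_addr.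
  - by rewrite gtn_eqF// (leq_trans (ltn_ord _))// -addnA leq_addr.
rewrite sum3D (sum3_swap23 (fun i j k => spline_kernel N j k * trip i k j)).
rewrite mulr2n mulrDl mul1r.
by congr (_ + _); apply: eq_sum3 => i j k; rewrite spline_kernelC.
Qed.

Lemma torus_int_sqr_cube N :
  torus_int (fun s => trigP (fun=> 1) N s ^+ 2 * trigP (fun k => k%:R ^+ 3) N s) =
  torus_int (fun s => trigP (fun=> 1) N s * spline_density N s).
Proof.
rewrite torus_int_PPP ?expr0n// torus_int_spline_density//; congr (_ * _).
apply: (@sum_trip_eq _ _ _ _ (fun i j k => k%:R ^+ 3 + 2 * j%:R ^+ 3)
  (fun i j k => spline_kernel N j k)) => i j ijN.
rewrite [RHS]addrC spline_kernel_resonant//; ring.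
Qed.

(** For [k = i + j], adding to [j^2 k + k^2 j - i^2 j] the same expression with
    [i] and [j] exchanged gives [i^3 + j^3 + k^3]. This replaces the integrations
    by parts that relate [I1] to [rho^2 Lambda^3 rho]. *)
Lemma torus_int_trilinear N :
  2 * torus_int (fun s => trigP (fun=> 1) N s * trigQ (fun k => - k%:R ^+ 2) N s *
    trigQ (fun k => - k%:R) N s) =
  torus_int (fun s => trigP (fun=> 1) N s ^+ 2 * trigP (fun k => k%:R ^+ 3) N s).
Proof.
rewrite torus_int_PPP ?expr0n// torus_int_PQQ ?expr0n ?oppr0//; congr (_ * _).
rewrite -sum3Z -[LHS](@eq_sum3 _ _ _ _ (fun i j k : 'I_N.+1 =>
  (2 * (- j%:R ^+ 2 * - k%:R + - k%:R ^+ 2 * - j%:R - - i%:R ^+ 2 * - j%:R)) * trip i j k)).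
  apply: (@sum_trip_eq _ _ _ _ (fun i j k => 2 * (- j%:R ^+ 2 * - k%:R +
    - k%:R ^+ 2 * - j%:R - - i%:R ^+ 2 * - j%:R))
    (fun i j k => k%:R ^+ 3 + 2 * j%:R ^+ 3)) => i j _.
  by rewrite natrD; ring.
by move=> i j k; rewrite mulrA.
Qed.

(** The term [n = 0] already contains the squared modulus of the sum of the [e_k]
    over [0 < k <= N], and the real part of that sum is half of the truncated
    function minus its mean. *)
Lemma spline_density_ge N s :
  4^-1 * (trigP (fun=> 1) N s - 2 * x 0%N) ^+ 2 <= spline_density N s.
Proof.
have mass_ge0 c : 0 <= mode_sqnorm c N s by rewrite addr_ge0 ?sqr_ge0.
rewrite /spline_density big_ord_recl/=.
have -> : 4^-1 * (trigP (fun=> 1) N s - 2 * x 0%N) ^+ 2 =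
    (\sum_(k < N.+1) tail_cut 0 k * modeP k s) ^+ 2.
  rewrite /trigP !big_ord_recl/= {1}/modeP mul0r cos0 sin0 /tail_cut/= mul0r add0r.
  under eq_bigr do rewrite mul1r.
  under [in RHS]eq_bigr do rewrite mul1r.
  by rewrite -mulr_sumr; field.
rewrite -[leLHS]addr0 lerD//; last by apply: sumr_ge0 => n _; rewrite addr_ge0 ?mulr_ge0.
by rewrite -[leLHS]add0r lerD ?mulr_ge0// lerDl sqr_ge0.
Qed.

End positivity.

(** * From trigonometric sums to their uniform limits *)

Section limits.
Context {R : realType}.
Variables x y : nat -> R.
Implicit Types (rho V D L H : R -> R) (F : nat -> R -> R).

Lemma uconv_subr (u : nat -> R -> R) f c : uconv u f ->
  uconv (fun N s => u N s - c) (fun s => f s - c).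
Proof.
move=> [d d0 ud]; exists d => // N s.
by rewrite (_ : _ - _ = u N s - f s)//; ring.
Qed.

(** The telescoping bound [1 / (k+1) ^ 2 <= 2 (1 / (k+1) - 1 / (k+2))] makes the
    partial sums, corrected by [2 A / (N+1)], nonincreasing, and bounds the remainder
    by the same quantity. *)
Lemma uconv_sumr F (A : R) : (forall k s, `|F k.+1 s| <= A / k.+1%:R ^+ 2) ->
  uconv (fun N s => \sum_(k < N.+1) F k s)
    (fun s => limn (fun N => \sum_(k < N.+1) F k s)).
Proof.
move=> FA; pose u N s := \sum_(k < N.+1) F k s; pose c := 2 * A.
have A0 : 0 <= A by have := le_trans (normr_ge0 _) (FA 0%N 0); rewrite expr1n divr1.
have step N s : `|u N.+1 s - u N s| <= c * (N.+1%:R^-1 - N.+2%:R^-1).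
  rewrite /u [in leLHS]big_ord_recr/= addrAC subrr add0r (le_trans (FA _ _))//.
  rewrite /c -mulrA [2 * _]mulrC -mulrA ler_wpM2l// -[N.+2%:R]natr1.
  have N0 : 0 < N.+1%:R :> R by [].
  have N1 : 1 <= N.+1%:R :> R by rewrite ler1n.
  set n := N.+1%:R in N0 N1 *.
  rewrite (_ : (n^-1 - (n + 1)^-1) * 2 = (n ^+ 2)^-1 * (2 * n / (n + 1))); last first.
    by field; rewrite !gt_eqF//; lra.
  by rewrite ler_peMr ?invr_ge0 ?sqr_ge0// ler_pdivlMr; lra.
have tail N M s : (N <= M)%N -> `|u M s - u N s| <= c * (N.+1%:R^-1 - M.+1%:R^-1).
  move=> /subnK <-; elim: (M - N)%N => [|n IH]; first by rewrite !subrr normr0 mulr0.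
  rewrite addSn -[_ - _](subrKA (u (n + N)%N s)).
  rewrite (le_trans (ler_normD _ _))// (le_trans (lerD (step _ _) IH))//.
  by rewrite -mulrDr addrC addrA subrK.
have cvg_u s : cvgn (u ^~ s).
  have cv : cvgn (fun N => u N s + c / N.+1%:R).
    apply: nonincreasing_is_cvgn.
      apply/nonincreasing_seqP => N /=; rewrite -subr_ge0.
      have := step N s; rewrite ler_norml mulrBr => /andP[_].
      move: (u N.+1 s) (u N s) (c / N.+1%:R) (c / N.+2%:R) => p q a b; lra.
    exists (u 0%N s - c) => _ [N _ <-]; have := tail 0%N N s (leq0n N).
    rewrite ler_norml invr1 mulrBr mulr1 => /andP[+ _] /=.
    have : 0 <= c / N.+1%:R by rewrite divr_ge0// mulr_ge0.
    by move: (u 0%N s) (u N s) (c / N.+1%:R) => p q a; lra.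
  have ch : (fun N => c / N.+1%:R) @ \oo --> (0 : R).
    rewrite -[X in _ --> X](mulr0 c); apply: cvgM; [exact: cvg_cst|exact: cvg_harmonic].
  have -> : u ^~ s = (fun N => u N s + c / N.+1%:R - c / N.+1%:R).
    by apply/funext => N; rewrite addrK.
  by apply: is_cvgB => //; apply: cvgP ch.
exists (fun N => c / N.+1%:R).
  rewrite -[X in _ --> X](mulr0 c); apply: cvgM; [exact: cvg_cst|exact: cvg_harmonic].
move=> N s; rewrite distrC -/(u N s).
have cn : (fun M => `|u M s - u N s|) @ \oo --> `|limn (u ^~ s) - u N s|.
  by apply: cvg_norm; apply: cvgB; [exact: cvg_u|exact: cvg_cst].
apply: (cvgr_to_le cn); near=> M; rewrite (le_trans (tail _ _ _ _))//.
  by near: M; exact: nbhs_infty_ge.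
rewrite ler_wpM2l// ?mulr_ge0// gerBl ?invr_ge0//.
Unshelve. all: by end_near. Qed.

Local Notation trigP := (trigP x y).
Local Notation trigQ := (trigQ x y).

Lemma torus_int_sqr_cube_cvg rho V :
  uconv (trigP (fun=> 1)) rho -> uconv (trigP (fun k => k%:R ^+ 3)) V ->
  torus_int (fun s => trigP (fun=> 1) N s ^+ 2 * trigP (fun k => k%:R ^+ 3) N s)
    @[N --> \oo] --> torus_int (fun s => rho s ^+ 2 * V s).
Proof.
move=> crho cV; have bP w N := bmeas_trigP x y w N.
have brho := uconv_bmeas (bP _) crho; have bV := uconv_bmeas (bP _) cV.
apply: uconv_torus_int => [N|]; first by apply: bmeasM => //; exact: bmeasX.
under eq_fun do under eq_fun do rewrite expr2.
under [X in uconv _ X]eq_fun do rewrite expr2.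
by apply: uconvM => //; [exact: bmeasM|exact: uconvM].
Qed.

(** A truncation [p_N] of [rho] may take negative values, so positivity is not
    available for [p_N] itself. But [p_N] can be replaced by [rho] in the integral
    against the nonnegative density, by orthogonality. *)
Lemma torus_int_cube_ge rho V : (forall s, 0 <= rho s) ->
  uconv (trigP (fun=> 1)) rho -> uconv (trigP (fun k => k%:R ^+ 3)) V ->
  4^-1 * torus_int (fun s => rho s * (rho s - 2 * x 0%N) ^+ 2) <=
  torus_int (fun s => rho s ^+ 2 * V s).
Proof.
move=> rho0 crho cV; have bP w N := bmeas_trigP x y w N.
have brho := uconv_bmeas (bP _) crho; have bS := bmeas_spline_density x y.
pose d N s := trigP (fun=> 1) N s - 2 * x 0%N.
have bd N : bmeas (d N) by apply: bmeasB => //; exact: bmeas_cst.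
have cd : uconv d (fun s => rho s - 2 * x 0%N) by exact: uconv_subr.
have bdl : bmeas (fun s => rho s - 2 * x 0%N) by exact: uconv_bmeas cd.
have dens N : torus_int (fun s => rho s * spline_density x y N s) =
    torus_int (fun s => trigP (fun=> 1) N s * spline_density x y N s).
  have cS : torus_int (fun s => trigP (fun=> 1) M s * spline_density x y N s)
      @[M --> \oo] --> torus_int (fun s => rho s * spline_density x y N s).
    apply: uconv_torus_int => [M|]; first exact: bmeasM.
    by apply: uconvM => //; exact: uconv_cst.
  apply: (cvg_unique _ cS) => //.
  apply: cvg_near_cst; near=> M.
  have NM : (N <= M)%N by near: M; exact: nbhs_infty_ge.
  by rewrite !torus_int_spline_density.
have clow : 4^-1 * torus_int (fun s => rho s * d N s ^+ 2) @[N --> \oo] -->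
    4^-1 * torus_int (fun s => rho s * (rho s - 2 * x 0%N) ^+ 2).
  apply: cvgM; first exact: cvg_cst.
  apply: uconv_torus_int => [N|]; first by apply: bmeasM => //; exact: bmeasX.
  under eq_fun do under eq_fun do rewrite expr2.
  under [X in uconv _ X]eq_fun do rewrite expr2.
  by apply: uconvM => //; [exact: bmeasM|exact: uconv_cst|exact: uconvM].
apply: (ler_cvg_to clow (torus_int_sqr_cube_cvg crho cV)).
apply: nearW => N; rewrite torus_int_sqr_cube -dens -torus_intZ; last first.
  by apply: bmeasM => //; exact: bmeasX.
apply: le_torus_int => [||s].
- by apply: bmeasZ; apply: bmeasM => //; exact: bmeasX.
- exact: bmeasM.
- by rewrite mulrCA ler_wpM2l//; exact: spline_density_ge.
Unshelve. all: by end_near. Qed.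

Lemma torus_int_trilinear_lim rho V L D :
  uconv (trigP (fun=> 1)) rho -> uconv (trigP (fun k => k%:R ^+ 3)) V ->
  uconv (trigQ (fun k => - k%:R ^+ 2)) L -> uconv (trigQ (fun k => - k%:R)) D ->
  2 * torus_int (fun s => rho s * L s * D s) = torus_int (fun s => rho s ^+ 2 * V s).
Proof.
move=> crho cV cL cD; have bP w N := bmeas_trigP x y w N.
have bQ w N := bmeas_trigQ x y w N.
have brho := uconv_bmeas (bP _) crho.
have bL := uconv_bmeas (bQ _) cL; have bD := uconv_bmeas (bQ _) cD.
have := torus_int_sqr_cube_cvg crho cV.
rewrite -(funext (torus_int_trilinear x y)).
apply: cvg_unique => //; apply: cvgM; first exact: cvg_cst.
apply: uconv_torus_int => [N|]; first by apply: bmeasM => //; exact: bmeasM.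
by apply: uconvM => //; [exact: bmeasM|exact: uconvM].
Qed.

Lemma torus_int_bilinear_lim L D v H : (forall k, v k ^+ 2 = k%:R ^+ 3) ->
  uconv (trigQ (fun k => - k%:R ^+ 2)) L -> uconv (trigQ (fun k => - k%:R)) D ->
  uconv (trigP v) H ->
  torus_int (fun s => L s * D s) = torus_int (fun s => H s ^+ 2).
Proof.
move=> v2 cL cD cH; have bP w N := bmeas_trigP x y w N.
have bQ w N := bmeas_trigQ x y w N; have bH := uconv_bmeas (bP _) cH.
have bL := uconv_bmeas (bQ _) cL; have bD := uconv_bmeas (bQ _) cD.
have cH2 : torus_int (fun s => trigP v N s ^+ 2) @[N --> \oo] -->
    torus_int (fun s => H s ^+ 2).
  apply: uconv_torus_int => [N|]; first exact: bmeasX.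
  under eq_fun do under eq_fun do rewrite expr2.
  by under [X in uconv _ X]eq_fun do rewrite expr2; exact: uconvM.
have sqrE N : torus_int (fun s => trigQ (fun k => - k%:R ^+ 2) N s *
    trigQ (fun k => - k%:R) N s) = torus_int (fun s => trigP v N s ^+ 2).
  by apply: torus_int_QQ_sqr => [|k]; rewrite ?expr0n ?oppr0// v2; ring.
move: cH2; rewrite -(funext sqrE); apply: cvg_unique => //.
by apply: uconv_torus_int => [N|]; [exact: bmeasM|exact: uconvM].
Qed.

End limits.

(** * Pointwise Fourier inversion *)

Section fourier_inversion.
Context {R : realType}.
Implicit Types (f g G : R -> R) (s t : R).

(** Expand the integral of [(c G - sum_k b_k e_k) ^ 2 >= 0], where [b_k] is the
    integral of [G e_k]. *)
Lemma bessel_inequality G (e : nat -> R -> R) (c : R) N :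
  bmeas G -> (forall k, bmeas (e k)) ->
  0 < c -> (forall j k, torus_int (fun t => e j t * e k t) = c * (j == k)%:R) ->
  \sum_(k < N) torus_int (fun t => G t * e k t) ^+ 2 <=
  c * torus_int (fun t => G t ^+ 2).
Proof.
move=> bG be c0 ortho; pose b k := torus_int (fun t => G t * e k t).
have bGe k : bmeas (fun t => G t * e k t) by exact: bmeasM.
have bee j k : bmeas (fun t => e j t * e k t) by exact: bmeasM.
have bG2 : bmeas (fun t => G t ^+ 2) by exact: bmeasX.
have : 0 <= torus_int (fun t => (c * G t - \sum_(k < N) b k * e k t) ^+ 2).
  by apply: torus_int_ge0 => t; rewrite sqr_ge0.
rewrite (@eq_torus_int _ _ (fun t => c ^+ 2 * G t ^+ 2
    - 2 * c * (\sum_(k < N) b k * (G t * e k t))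
    + \sum_(j < N) \sum_(k < N) b j * b k * (e j t * e k t))); last first.
  move=> t; rewrite sqrrB exprMn; congr (_ - _ + _).
    rewrite -mulr_natl !mulrA -[2 * c * _]mulrA !mulr_sumr.
    by apply: eq_bigr => k _; ring.
  rewrite expr2 big_distrlr/=; apply: eq_bigr => j _; apply: eq_bigr => k _; ring.
have bs : bmeas (fun t => \sum_(k < N) b k * (G t * e k t)).
  by apply: bmeas_sum => k; exact: bmeasZ.
have bss (j : 'I_N) : bmeas (fun t => \sum_(k < N) b j * b k * (e j t * e k t)).
  by apply: bmeas_sum => k; exact: bmeasZ.
rewrite torus_intD; last 2 first.
- by apply: bmeasB; exact: bmeasZ.
- exact: bmeas_sum.
rewrite torus_intB ?torus_intZ//; try exact: bmeasZ.
rewrite !torus_int_sum => [||k]//; last exact: bmeasZ.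
rewrite (eq_bigr (fun k : 'I_N => b k ^+ 2)) => [|k _]; last by rewrite torus_intZ// expr2.
rewrite [X in _ + X](eq_bigr (fun k : 'I_N => c * b k ^+ 2)) => [|j _]; last first.
  rewrite torus_int_sum => [|k]; last exact: bmeasZ.
  rewrite (bigD1 j)//= big1 ?addr0 => [|k kj].
    by rewrite torus_intZ// ortho eqxx mulr1; ring.
  rewrite torus_intZ// ortho (_ : (j == k :> nat) = false) ?mulr0//.
  by apply/negbTE; move: kj; rewrite -val_eqE eq_sym.
rewrite -mulr_sumr => h; rewrite -(ler_pM2l c0) -subr_ge0; move: h; rewrite -/b.
move: (\sum_(_ < _) _) (torus_int _) => p q.
by rewrite (_ : _ - _ + _ = c * (c * q) - c * p)//; ring.
Qed.

Lemma bessel_cvg0 G (e : nat -> R -> R) (c : R) : bmeas G -> (forall k, bmeas (e k)) ->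
  0 < c -> (forall j k, torus_int (fun t => e j t * e k t) = c * (j == k)%:R) ->
  torus_int (fun t => G t * e k t) @[k --> \oo] --> 0.
Proof.
move=> bG be c0 ortho; pose b k := torus_int (fun t => G t * e k t).
have cb : cvgn (series (fun k => b k ^+ 2)).
  apply: nondecreasing_is_cvgn.
    apply/nondecreasing_seqP => n.
    by rewrite !seriesEord/= big_ord_recr/= lerDl sqr_ge0.
  exists (c * torus_int (fun t => G t ^+ 2)) => _ [N _ <-].
  by rewrite seriesEord; exact: bessel_inequality.
have b2 := cvg_series_cvg_0 cb.
apply/cvgrPdist_lt => eps eps0; near=> k.
rewrite sub0r normrN -[_ < _]/(`|b k| < eps) -(@ltr_pXn2r _ 2) ?nnegrE//; last exact: ltW.
rewrite real_normK ?num_real//; near: k.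
have /cvgrPdist_lt/(_ (eps ^+ 2)) := b2; rewrite exprn_gt0// => /(_ isT).
by apply: filterS => k; rewrite sub0r normrN ger0_norm// sqr_ge0.
Unshelve. all: by end_near. Qed.

Section shifted_harmonics.
Variable s : R.
Let u k := cos (k%:R * s).
Let v k := - sin (k%:R * s).

Lemma modeP_shift k t : modeP u v k t = cos (k%:R * (t - s)).
Proof. by rewrite /modeP mulrBr cosB /u /v; ring. Qed.

Lemma modeQ_shift k t : modeQ u v k t = sin (k%:R * (t - s)).
Proof. by rewrite /modeQ mulrBr sinB /u /v; ring. Qed.

Lemma torus_int_PP_shift j k :
  torus_int (fun t => modeP u v j.+1 t * modeP u v k.+1 t) = pi * (j == k)%:R.
Proof.
have [<-|jk] := eqVneq j k; last by rewrite torus_int_PP_eq0// mulr0.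
have [bP bQ _ _] := bmeas_PQ u v j.+1 j.+1.
have : torus_int (fun t => modeP u v j.+1 t * modeP u v j.+1 t +
    modeQ u v j.+1 t * modeQ u v j.+1 t) = 2 * pi.
  rewrite -[RHS]mul1r -torus_int_cst; apply: eq_torus_int => t.
  by rewrite modeP_shift modeQ_shift -!expr2 cos2Dsin2.
by rewrite torus_intD// torus_int_QQ// mulr1; lra.
Qed.

Lemma torus_int_cos_shift_cvg0 G : bmeas G ->
  torus_int (fun t => G t * cos (k%:R * (t - s))) @[k --> \oo] --> 0.
Proof.
move=> bG; pose T k := torus_int (fun t => G t * cos (k%:R * (t - s))).
suff : (fun k => T k.+1) @ \oo --> 0 by rewrite (cvg_shiftS T).
rewrite /T; under eq_fun do under eq_torus_int do rewrite -modeP_shift.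
apply: (@bessel_cvg0 _ (fun k => modeP u v k.+1) pi) => //.
- by move=> k; exact: bmeas_modeP.
- exact: pi_gt0.
- exact: torus_int_PP_shift.
Qed.

Lemma torus_int_sin_shift_cvg0 G : bmeas G ->
  torus_int (fun t => G t * sin (k%:R * (t - s))) @[k --> \oo] --> 0.
Proof.
move=> bG; pose T k := torus_int (fun t => G t * sin (k%:R * (t - s))).
suff : (fun k => T k.+1) @ \oo --> 0 by rewrite (cvg_shiftS T).
rewrite /T; under eq_fun do under eq_torus_int do rewrite -modeQ_shift.
apply: (@bessel_cvg0 _ (fun k => modeQ u v k.+1) pi) => //.
- by move=> k; exact: bmeas_modeQ.
- exact: pi_gt0.
- by move=> j k; rewrite torus_int_QQ//; exact: torus_int_PP_shift.
Qed.

End shifted_harmonics.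

Definition dirichlet N (u : R) := 1 + \sum_(k < N) 2 * cos (k.+1%:R * u).

(** The product is [sin ((N + 1/2) u)]; in this form the two terms are integrals
    against harmonics of integer frequency, to which Bessel's inequality applies. *)
Lemma dirichlet_sin N u :
  sin (2^-1 * u) * dirichlet N u =
  cos (2^-1 * u) * sin (N%:R * u) + sin (2^-1 * u) * cos (N%:R * u).
Proof.
elim: N => [|N IH].
  by rewrite /dirichlet big_ord0 mul0r sin0 cos0; ring.
have -> : dirichlet N.+1 u = dirichlet N u + 2 * cos (N.+1%:R * u).
  by rewrite /dirichlet big_ord_recr/= addrA.
rewrite mulrDr IH (_ : N%:R * u = N.+1%:R * u - (2^-1 * u + 2^-1 * u)); last first.
  by rewrite -natr1; field.
rewrite sinB cosB cosD sinD.
have := cos2Dsin2 (2^-1 * u).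
move: (cos (2^-1 * u)) (sin (2^-1 * u)) (cos _) (sin _) => c h C S ch.
rewrite -[in RHS](mul1r C) -[in RHS](mul1r S) -ch; ring.
Qed.

Lemma measurable_inv : measurable_fun setT (fun x : R => x^-1).
Proof.
rewrite -(setUv [set 0]); apply/measurable_funU => //; first exact: measurableC.
split; first exact: measurable_fun_set1.
apply: open_continuous_measurable_fun.
  by apply: closed_openC; exact: closed_eq.
by move=> x; rewrite inE/= => /eqP x0; exact: inv_continuous.
Qed.

Lemma bmeas_cos_shift (a s : R) : bmeas (fun t => cos (a * (t - s))).
Proof.
under eq_fun do rewrite mulrBr cosB; have := bmeas_cosM a; have := bmeas_sinM a.
by move=> ? ?; apply: bmeasD; apply: bmeasM => //; exact: bmeas_cst.
Qed.

Lemma bmeas_sin_shift (a s : R) : bmeas (fun t => sin (a * (t - s))).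
Proof.
under eq_fun do rewrite mulrBr sinB; have := bmeas_cosM a; have := bmeas_sinM a.
by move=> ? ?; apply: bmeasB; apply: bmeasM => //; exact: bmeas_cst.
Qed.

Lemma bmeas_dirichlet N s : bmeas (fun t => dirichlet N (t - s)).
Proof.
apply: bmeasD; first exact: bmeas_cst.
by apply: bmeas_sum => k; apply: bmeasZ; exact: bmeas_cos_shift.
Qed.

Lemma torus_int_dirichlet N s : torus_int (fun t => dirichlet N (t - s)) = 2 * pi.
Proof.
rewrite torus_intD; [|exact: bmeas_cst|]; last first.
  by apply: bmeas_sum => k; apply: bmeasZ; exact: bmeas_cos_shift.
rewrite torus_int_cst mul1r torus_int_sum => [|k]; last first.
  by apply: bmeasZ; exact: bmeas_cos_shift.
rewrite big1 ?addr0// => k _; rewrite torus_intZ; last exact: bmeas_cos_shift.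
under eq_torus_int do rewrite -modeP_shift.
by rewrite (torus_int_harmonic (harmonic_pair_mode _ _ _)) ?mulr0.
Qed.

(** [fcos f k + i fsin f k] is the Fourier coefficient of [f] at [k]. *)
Definition fcos f (k : nat) := (2 * pi)^-1 * torus_int (fun t => f t * cos (k%:R * t)).
Definition fsin f (k : nat) := - ((2 * pi)^-1 * torus_int (fun t => f t * sin (k%:R * t))).
Definition fcos_half f k := if k == 0%N then fcos f 0 / 2 else fcos f k.

Lemma trigP_fourier f N s : bmeas f ->
  trigP (fcos_half f) (fsin f) (fun=> 1) N s =
  (2 * pi)^-1 * torus_int (fun t => f t * dirichlet N (t - s)).
Proof.
move=> bf.
have bfc (a r : R) : bmeas (fun t => f t * cos (a * (t - r))).
  by apply: bmeasM => //; exact: bmeas_cos_shift.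
rewrite /trigP big_ord_recl/= /modeP !mul0r cos0 sin0 /fcos_half/=.
under eq_torus_int do rewrite /dirichlet mulrDr mulr1 mulr_sumr.
rewrite torus_intD//; last first.
  by apply: bmeas_sum => k; apply: bmeasM => //; apply: bmeasZ; exact: bmeas_cos_shift.
rewrite [RHS]mulrDr; congr (_ + _).
  rewrite /fcos; under eq_torus_int do rewrite mul0r cos0 mulr1.
  by rewrite mulr0 subr0 mul1r mulr1 mulrC divfK.
rewrite torus_int_sum => [|k]; last first.
  by apply: bmeasM => //; apply: bmeasZ; exact: bmeas_cos_shift.
rewrite mulr_sumr; apply: eq_bigr => k _; rewrite /bump/= add1n.
have bc : bmeas (fun t => f t * cos (k.+1%:R * t))
  by apply: bmeasM => //; exact: bmeas_cosM.
have bs : bmeas (fun t => f t * sin (k.+1%:R * t)).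
  by apply: bmeasM => //; exact: bmeas_sinM.
rewrite (@eq_torus_int _ _ (fun t => 2 * (cos (k.+1%:R * s) * (f t * cos (k.+1%:R * t)) +
  sin (k.+1%:R * s) * (f t * sin (k.+1%:R * t))))); last first.
  by move=> t; rewrite mulrBr cosB; ring.
rewrite torus_intZ; last by apply: bmeasD; exact: bmeasZ.
rewrite torus_intD; [|exact: bmeasZ|exact: bmeasZ].
by rewrite !torus_intZ// /fcos /fsin; ring.
Qed.

(** The hypothesis makes [(f t - f s) / sin ((t - s) / 2)] bounded, so the error,
    the mean of [(f t - f s) D_N (t - s)], is a sum of Fourier coefficients of two
    bounded functions, which tend to 0 by Bessel's inequality. *)
Lemma fourier_inversion f K s : bmeas f ->
  (forall t, `|f t - f s| <= K * `|sin (2^-1 * (t - s))|) ->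
  trigP (fcos_half f) (fsin f) (fun=> 1) N s @[N --> \oo] --> f s.
Proof.
move=> bf fK; pose h t := 2^-1 * (t - s).
pose g t := (f t - f s) * (sin (h t))^-1.
have gE t : g t * sin (h t) = f t - f s.
  rewrite /g; have [h0|h0] := eqVneq (sin (h t)) 0; last by rewrite divfK.
  have := fK t; rewrite -/(h t) h0 normr0 !mulr0 normr_le0 => /eqP ->//.
have bg : bmeas g.
  have [mf _] := bf; have [ms _] := bmeas_sin_shift 2^-1 s; split.
    apply: measurable_funM; first by apply: measurable_funB => //; exact: measurable_cst.
    by apply: measurableT_comp ms; exact: measurable_inv.
  exists K => t; rewrite /g.
  have [h0|h0] := eqVneq (sin (h t)) 0.
    (* The hypothesis at [t = s + pi], where the sine is 1, gives [0 <= K]. *)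
    rewrite h0 invr0 mulr0 normr0; have := fK (s + pi).
    rewrite (_ : 2^-1 * (s + pi - s) = pi / 2); last by field.
    by rewrite sin_pihalf normr1 mulr1; exact: le_trans.
  by rewrite normrM normfV ler_pdivrMr ?normr_gt0//; exact: fK.
clearbody g.
have bgc : bmeas (fun t => g t * cos (h t))
  by apply: bmeasM => //; exact: bmeas_cos_shift.
have bgs : bmeas (fun t => g t * sin (h t)).
  by apply: bmeasM => //; exact: bmeas_sin_shift.
have errE N : trigP (fcos_half f) (fsin f) (fun=> 1) N s - f s =
    (2 * pi)^-1 * (torus_int (fun t => g t * cos (h t) * sin (N%:R * (t - s))) +
                   torus_int (fun t => g t * sin (h t) * cos (N%:R * (t - s)))).
  have bD := bmeas_dirichlet N s.
  rewrite trigP_fourier// -torus_intD; last 2 first.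
  - by apply: bmeasM => //; exact: bmeas_sin_shift.
  - by apply: bmeasM => //; exact: bmeas_cos_shift.
  rewrite -[X in _ - X](mulKf (lt0r_neq0 twopi_gt0)) -mulrBr; congr (_ * _).
  rewrite [2 * pi * _]mulrC -(torus_int_dirichlet N s) -torus_intZ// -torus_intB//.
  - apply: eq_torus_int => t; rewrite -mulrBl -gE -/(h t).
    by rewrite -!mulrA -mulrDr /h -dirichlet_sin.
  - exact: bmeasM.
  - exact: bmeasZ.
apply/subr_cvg0; rewrite (funext errE) -[X in _ --> X](mulr0 (2 * pi)^-1).
apply: cvgM; first exact: cvg_cst.
rewrite -[X in _ --> X](addr0 0); apply: cvgD.
- exact: torus_int_sin_shift_cvg0.
- exact: torus_int_cos_shift_cvg0.
Qed.

End fourier_inversion.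

(** * Fourier coefficients of smooth functions *)

Section smooth_functions.
Context {R : realType}.
Implicit Types (f : R -> R) (s t : R).

(** By the mean value theorem [sin (t / 2) >= t / 2 * cos (t / 2)], hence
    [sin t >= t * cos (t / 2) ^ 2 = t * (1 + cos t) / 2]. *)
Lemma half_le_sin t : 0 <= t <= pi / 2 -> t / 2 <= sin t.
Proof.
move=> /andP[t0 tpi].
have [->|t_neq0] := eqVneq t 0; first by rewrite mul0r sin0.
have ht : 0 < t / 2 by rewrite divr_gt0// lt_def t_neq0.
have [c /[!in_itv]/= /andP[c0 ct] sE] : exists2 c, c \in `]0, (t / 2)[%R &
    sin (t / 2) - sin 0 = cos c * (t / 2 - 0).
  apply: MVT => //.
  by apply: continuous_subspaceT; exact: continuous_sin.
rewrite sin0 !subr0 in sE.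
have tE : t = t / 2 *+ 2 by rewrite -mulr_natr divfK.
have pi0 := @pi_gt0 R.
have cosc : cos (t / 2) <= cos c.
  by rewrite ltW// ltr_cos ?in_itv/=; lra.
have cost : 0 <= cos (t / 2) by apply: cos_ge0_pihalf; lra.
have cos0t : 0 <= cos t by apply: cos_ge0_pihalf; lra.
have -> : sin t = 2 * (cos (t / 2) * sin (t / 2)).
  by rewrite mulr_natl -sin_mulr2n -tE.
have c2 : 1 <= 2 * cos (t / 2) ^+ 2.
  have : cos t = cos (t / 2) ^+ 2 *+ 2 - 1 by rewrite -cos_mulr2n -tE.
  by rewrite -mulr_natl; lra.
rewrite sE (_ : 2 * _ = t / 2 * (2 * (cos (t / 2) * cos c))); last by ring.
rewrite ler_peMr ?(ltW ht)// (le_trans c2)// expr2.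
by rewrite ler_wpM2l// ler_wpM2l.
Qed.

Lemma torus_representative s : exists (m : int) t,
  [/\ - pi <= t, t <= pi & s = t + m%:~R * (2 * pi)].
Proof.
pose m := Num.floor ((s + pi) / (2 * pi)).
exists m, (s - m%:~R * (2 * pi)).
have /andP[lo hi] := Num.Theory.floor_itv ((s + pi) / (2 * pi)).
rewrite -/m ler_pdivlMr ?twopi_gt0// in lo.
rewrite -/m ltr_pdivrMr ?twopi_gt0// intrD in hi.
by split; [lra|lra|ring].
Qed.

Lemma periodic_continuous_bounded f : periodic_torus f -> continuous f ->
  exists M : R, forall s, `|f s| <= M.
Proof.
move=> pf cf.
have [c _ cmax] : exists2 c, c \in `[- pi, pi]%R &
    forall t, t \in `[- pi, pi]%R -> `|f t| <= `|f c|.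
  apply: (@EVT_max R (fun t => `|f t|)); first by have := @pi_gt0 R; lra.
  apply: continuous_subspaceT => x; apply: continuous_comp; first exact: cf.
  exact: norm_continuous.
exists `|f c| => s; have [m [t [t0 t1 ->]]] := torus_representative s.
by rewrite periodic_int// cmax// in_itv/= t0.
Qed.

Lemma smooth_torus_continuous f : smooth_torus f -> continuous f.
Proof.
move=> [_ df] s; apply: differentiable_continuous.
by apply/derivable1_diffP; exact: (df 0%N).
Qed.

Lemma smooth_torus_derive f : smooth_torus f -> smooth_torus (derive1 f).
Proof.
move=> [pf df]; split=> [s|n s].
  rewrite /derive1 (_ : (fun h : R => h^-1 *: (f (h + (s + 2 * pi)) - f (s + 2 * pi))) =
    (fun h => h^-1 *: (f (h + s) - f s)))//.
  by apply/funext => h; rewrite addrA !pf.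
by have := df n.+1 s; rewrite /derive1n iterSr.
Qed.

Lemma smooth_torus_is_derive f s : smooth_torus f ->
  is_derive s (1 : R) f (derive1 f s).
Proof. by move=> [_ df]; rewrite derive1E; apply/derivableP; exact: (df 0%N). Qed.

Lemma smooth_torus_bounded f : smooth_torus f -> exists M : R, forall s, `|f s| <= M.
Proof.
by move=> sf; apply: periodic_continuous_bounded; [case: sf|exact: smooth_torus_continuous].
Qed.

Lemma smooth_torus_bmeas f : smooth_torus f -> bmeas f.
Proof.
move=> sf; have [M fM] := smooth_torus_bounded sf.
by apply: continuous_bmeas fM; exact: smooth_torus_continuous.
Qed.

Lemma smooth_torus_lipschitz f : smooth_torus f ->
  exists M : R, forall s t, `|f s - f t| <= M * `|s - t|.
Proof.
move=> sf; have [M dfM] := smooth_torus_bounded (smooth_torus_derive sf).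
exists M => s t; wlog ts : s t / t <= s.
  move=> h; have [/h//|/ltW/h] := leP t s.
  by rewrite distrC [`|t - s|]distrC.
have [c _ ->] : exists2 c, c \in `[t, s]%R & f s - f t = derive1 f c * (s - t).
  apply: MVT_segment => // [x _|]; first exact: smooth_torus_is_derive.
  by apply: continuous_subspaceT; exact: smooth_torus_continuous.
by rewrite normrM ler_wpM2r.
Qed.

(** Both sides depend on [t - s] modulo [2 pi] only; choose the representative of
    absolute value at most [pi] and use the Lipschitz bound. *)
Lemma smooth_torus_chord f : smooth_torus f ->
  exists K : R, forall s t, `|f t - f s| <= K * `|sin (2^-1 * (t - s))|.
Proof.
move=> sf; have [M fM] := smooth_torus_lipschitz sf; have [pf _] := sf.
exists (M * 4) => s t; have [m [r [r0 r1 tsE]]] := torus_representative (t - s).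
have -> : f t = f (s + r) by rewrite -(periodic_int m (s + r) pf) -addrA -tsE subrKC.
have -> : `|sin (2^-1 * (t - s))| = `|sin (2^-1 * r)|.
  have /(periodic_int m r) <- : periodic_torus (fun u : R => `|sin (2^-1 * u)|).
    move=> u; rewrite (_ : 2^-1 * (u + 2 * pi) = 2^-1 * u + pi); last by field.
    by rewrite sinDpi normrN.
  by rewrite tsE.
rewrite (le_trans (fM _ _))// [s + r]addrC addrK -mulrA ler_wpM2l//.
  by have := le_trans (normr_ge0 _) (fM 1 0); rewrite subr0 normr1 mulr1.
clear tsE; wlog r_ge0 : r r0 r1 / 0 <= r.
  move=> h; have [/(h r r0 r1)//|rneg] := leP 0 r.
  by rewrite -normrN -[in leRHS]normrN -sinN -mulrN; apply: h; lra.
have sr := @half_le_sin (2^-1 * r).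
rewrite ger0_norm// (le_trans _ (ler_wpM2l _ (ler_norm _)))//.
by have := sr; rewrite (_ : 0 <= _ <= _ = true) => [/(_ isT)|]; lra.
Qed.

Lemma smooth_fourier_inversion f s : smooth_torus f ->
  trigP (fcos_half f) (fsin f) (fun=> 1) N s @[N --> \oo] --> f s.
Proof.
move=> sf; have [K fK] := smooth_torus_chord sf.
exact: (fourier_inversion (smooth_torus_bmeas sf) (fK s)).
Qed.

(** Integration by parts; the boundary terms cancel by periodicity. *)
Lemma torus_int_derive_mul f g dg : smooth_torus f -> bmeas g -> periodic_torus g ->
  (forall s, is_derive s (1 : R) g (dg s)) -> continuous dg -> bmeas dg ->
  torus_int (fun s => derive1 f s * g s) = - torus_int (fun s => f s * dg s).
Proof.
move=> sf bg pg Dg cdg bdg; have bf := smooth_torus_bmeas sf.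
have sf' := smooth_torus_derive sf; have bf' := smooth_torus_bmeas sf'.
apply/eqP; rewrite -addr_eq0 -torus_intD; [|exact: bmeasM|exact: bmeasM].
apply/eqP/(@torus_int_derive _ (fun s => f s * g s)).
- move=> s; apply: (is_derive_eq (is_deriveM (smooth_torus_is_derive s sf) (Dg s))).
  by rewrite addrC [g s *: _]mulrC.
- have cg : continuous g.
    by move=> s; apply: differentiable_continuous; apply/derivable1_diffP; case: (Dg s).
  move=> s; apply: cvgD; apply: cvgM.
  + exact: smooth_torus_continuous.
  + exact: cg.
  + exact: smooth_torus_continuous.
  + exact: cdg.
- by move=> s; rewrite pg; case: sf => ->.
Qed.

Lemma fcos_derive f k : smooth_torus f -> fcos (derive1 f) k = - (k%:R * fsin f k).
Proof.
move=> sf; have bs := bmeas_sinM (k%:R : R); have bf := smooth_torus_bmeas sf.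
have ibp : torus_int (fun s => derive1 f s * cos (k%:R * s)) =
    - torus_int (fun s => f s * (- k%:R * sin (k%:R * s))).
  apply: torus_int_derive_mul => //.
  - exact: bmeas_cosM.
  - by move=> s; exact: (cos_intM k).
  - by move=> s; exact: is_derive_cosM.
  - by move=> s; apply: cvgM; [exact: cvg_cst|exact: continuous_sinM].
  - exact: bmeasZ.
rewrite /fcos /fsin ibp; under eq_torus_int do rewrite mulrCA.
by rewrite torus_intZ; [ring|exact: bmeasM].
Qed.

Lemma fsin_derive f k : smooth_torus f -> fsin (derive1 f) k = k%:R * fcos f k.
Proof.
move=> sf; have bc := bmeas_cosM (k%:R : R); have bf := smooth_torus_bmeas sf.
have ibp : torus_int (fun s => derive1 f s * sin (k%:R * s)) =
    - torus_int (fun s => f s * (k%:R * cos (k%:R * s))).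
  apply: torus_int_derive_mul => //.
  - exact: bmeas_sinM.
  - by move=> s; exact: (sin_intM k).
  - by move=> s; exact: is_derive_sinM.
  - by move=> s; apply: cvgM; [exact: cvg_cst|exact: continuous_cosM].
  - exact: bmeasZ.
rewrite /fcos /fsin ibp; under eq_torus_int do rewrite mulrCA.
by rewrite torus_intZ; [ring|exact: bmeasM].
Qed.

(** Each derivative multiplies the coefficients by [k], and the coefficients of a
    bounded function are bounded. *)
Lemma fourier_decay n f : smooth_torus f -> exists M : R, forall k,
  k%:R ^+ n * `|fcos f k| <= M /\ k%:R ^+ n * `|fsin f k| <= M.
Proof.
elim: n f => [|n IH] f sf.
  have [M fM] := smooth_torus_bounded sf; have bf := smooth_torus_bmeas sf.
  have bound (e : R -> R) : bmeas e -> (forall s, `|e s| <= 1) ->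
      `|(2 * pi)^-1 * torus_int (fun t => f t * e t)| <= M.
    move=> be e1; rewrite normrM gtr0_norm ?invr_gt0 ?twopi_gt0//.
    rewrite ler_pdivrMl ?twopi_gt0// mulrC.
    apply: torus_int_le_bound; first exact: bmeasM.
    by move=> s; rewrite normrM -[leRHS]mulr1 ler_pM.
  exists M => k; rewrite expr0 !mul1r /fsin normrN.
  split; apply: bound => [|s].
  - exact: bmeas_cosM.
  - exact: cos_max.
  - exact: bmeas_sinM.
  - exact: sin_max.
have [M fM] := IH _ (smooth_torus_derive sf).
exists M => k; have := fM k; rewrite fcos_derive// fsin_derive// normrN !normrM normr_nat.
by rewrite !mulrA -exprSr => -[? ?].
Qed.

End smooth_functions.

(** * Powers of the Laplacian and the integral I1 *)

Section fractional_laplacian.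
Context {R : realType}.
Implicit Types (f g : R -> R) (w : nat -> R) (s t a : R).

Lemma Re_Lambda_mode a f s (k : int) : bmeas f -> complex.Re (Lambda_mode a f s k) =
  `|k%:~R| `^ a * ((2 * pi)^-1 *
    (torus_int (fun t => f t * cos (k%:~R * t)) * cos (k%:~R * s) +
     torus_int (fun t => f t * sin (k%:~R * t)) * sin (k%:~R * s))).
Proof.
move=> bf; rewrite /Lambda_mode /fourier /torus_intC /expi /=.
have -> : (fun t => f t * cos (- (k%:~R * t)) - 0 * sin (- (k%:~R * t))) =
    (fun t => f t * cos (k%:~R * t)).
  by apply/funext => t; rewrite cosN; ring.
have -> : (fun t => f t * sin (- (k%:~R * t)) + 0 * cos (- (k%:~R * t))) =
    (fun t => -1 * (f t * sin (k%:~R * t))).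
  by apply/funext => t; rewrite sinN; ring.
rewrite torus_intZ; [ring|apply: bmeasM => //; exact: bmeas_sinM].
Qed.

Lemma sum_symmetric (g : int -> R) N : (forall k, g (- k) = g k) -> g 0 = 0 ->
  \sum_(i < N.*2.+1) g (i%:Z - N%:Z) = \sum_(k < N.+1) 2 * g k%:Z.
Proof.
move=> gN g0; elim: N => [|N IH].
  by rewrite !big_ord1 subrr g0 mulr0.
rewrite doubleS big_ord_recl big_ord_recr [RHS]big_ord_recr -IH /= sub0r gN.
rewrite (eq_bigr (fun i : 'I_N.*2.+1 => g (i%:Z - N%:Z))); last first.
  by move=> i _; rewrite /bump/= add1n -[i.+1]addn1 -[N.+1]addn1 !PoszD; congr g; ring.
rewrite (_ : Posz (bump 0 N.*2.+1) - _ = N.+1); first by ring.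
by rewrite /bump/= add1n -addnn -[(N + N).+2]/(N.+1 + N).+1 -addnS PoszD addrK.
Qed.

Lemma Re_Lambda_partial a f s N : bmeas f -> a != 0 ->
  complex.Re (Lambda_partial a f s N) =
  trigP (fcos_half f) (fsin f) (fun k => k%:R `^ a) N s.
Proof.
move=> bf a0; rewrite /Lambda_partial.
have ReD : {morph (@complex.Re R) : x y / x + y} by case=> ? ? [].
rewrite (big_morph _ ReD (erefl : complex.Re 0 = 0)).
rewrite (@sum_symmetric (fun k => complex.Re (Lambda_mode a f s k))).
- apply: eq_bigr => k _; rewrite Re_Lambda_mode// normr_nat.
  have [k0|k0] := eqVneq (k : nat) 0%N.
    by rewrite k0 powR0// !mul0r mulr0.
  by rewrite /modeP /fcos_half (negbTE k0) /fcos /fsin -!pmulrn; ring.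
- move=> k; rewrite !Re_Lambda_mode// mulrNz normrN mulNr cosN sinN.
  under eq_torus_int do rewrite mulNr cosN.
  under [X in _ + X * _]eq_torus_int do rewrite mulNr sinN mulrN -mulN1r.
  rewrite torus_intZ; last by apply: bmeasM => //; exact: bmeas_sinM.
  by ring.
- by rewrite Re_Lambda_mode// normr0 powR0// mul0r.
Qed.

Lemma normr_modeP (x y : nat -> R) k s : `|modeP x y k s| <= `|x k| + `|y k|.
Proof.
rewrite /modeP (le_trans (ler_normB _ _))// !normrM.
by rewrite lerD// ler_piMr ?cos_max ?sin_max.
Qed.

(** By the decay of the coefficients to order 5, the terms are [O (1 / k ^ 2)]. *)
Lemma uconv_trigP f w : smooth_torus f -> (forall k, `|w k.+1| <= k.+1%:R ^+ 3) ->
  uconv (trigP (fcos_half f) (fsin f) w)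
    (fun s => limn (fun N => trigP (fcos_half f) (fsin f) w N s)).
Proof.
move=> sf wle; have [M fM] := fourier_decay 5 sf.
apply: (@uconv_sumr _ (fun k s => w k * (2 * modeP (fcos_half f) (fsin f) k s))
  (4 * M)) => k s.
have [xM yM] := fM k.+1.
rewrite ler_pdivlMr ?exprn_gt0// normrM normrM (ger0_norm (ler0n _ 2)).
have := normr_modeP (fcos_half f) (fsin f) k.+1 s; rewrite {2}/fcos_half/= => mk.
apply: (@le_trans _ _
  (k.+1%:R ^+ 3 * (2 * (`|fcos f k.+1| + `|fsin f k.+1|)) * k.+1%:R ^+ 2)).
  by rewrite ler_wpM2r ?exprn_ge0// ler_pM// ler_wpM2l.
rewrite (_ : _ * _ = 2 * (k.+1%:R ^+ 5 * `|fcos f k.+1| + k.+1%:R ^+ 5 * `|fsin f k.+1|)).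
  by move: (_ * `|fcos f _|) (_ * `|fsin f _|) xM yM => p q; lra.
by ring.
Qed.

Lemma uconv_Lambda a f : smooth_torus f -> 0 < a <= 3 ->
  uconv (trigP (fcos_half f) (fsin f) (fun k => k%:R `^ a)) (Lambda a f).
Proof.
move=> sf /andP[a0 a3]; have bf := smooth_torus_bmeas sf.
have -> : Lambda a f =
    (fun s => limn (fun N => trigP (fcos_half f) (fsin f) (fun k => k%:R `^ a) N s)).
  apply/funext => s; congr (limn _); apply/funext => N.
  by rewrite Re_Lambda_partial// gt_eqF.
apply: uconv_trigP => // k.
by rewrite ger0_norm ?powR_ge0// -powR_mulrn// ler_powR// ler1n.
Qed.

Lemma uconv_trigP_derive f w g : smooth_torus f ->
  uconv (trigP (fcos_half (derive1 f)) (fsin (derive1 f)) w) g ->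
  uconv (trigQ (fcos_half f) (fsin f) (fun k => - (k%:R * w k))) g.
Proof.
move=> sf; suff -> : trigP (fcos_half (derive1 f)) (fsin (derive1 f)) w =
  trigQ (fcos_half f) (fsin f) (fun k => - (k%:R * w k)) by [].
apply/funext => N; apply/funext => s; apply: eq_bigr => k _.
rewrite /modeP /modeQ fsin_derive// /fcos_half.
case: eqP => [->|_]; first by rewrite fcos_derive// !mul0r sin0; ring.
by rewrite fcos_derive//; ring.
Qed.

Lemma uconv_fourier f : smooth_torus f ->
  uconv (trigP (fcos_half f) (fsin f) (fun=> 1)) f.
Proof.
move=> sf; have := @uconv_trigP f (fun=> 1) sf.
suff -> : (fun s => limn (fun N => trigP (fcos_half f) (fsin f) (fun=> 1) N s)) = f.
  by apply=> k; rewrite normr1 exprn_ege1// ler1n.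
by apply/funext => s; apply: cvg_lim => //; exact: smooth_fourier_inversion.
Qed.

Lemma uconv_derive1 f : smooth_torus f ->
  uconv (trigQ (fcos_half f) (fsin f) (fun k => - k%:R)) (derive1 f).
Proof.
move=> sf; have := uconv_trigP_derive sf (uconv_fourier (smooth_torus_derive sf)).
by under eq_fun do rewrite mulr1.
Qed.

Lemma uconv_Lambda_derive1 f : smooth_torus f ->
  uconv (trigQ (fcos_half f) (fsin f) (fun k => - k%:R ^+ 2)) (Lambda 1 (derive1 f)).
Proof.
move=> sf; have /(uconv_trigP_derive sf) : uconv
    (trigP (fcos_half (derive1 f)) (fsin (derive1 f)) (fun k => k%:R `^ 1))
    (Lambda 1 (derive1 f)).
  by apply: uconv_Lambda; [exact: smooth_torus_derive|lra].
by under eq_fun do rewrite powRr1// -expr2.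
Qed.

Lemma uconv_Lambda3 f : smooth_torus f ->
  uconv (trigP (fcos_half f) (fsin f) (fun k => k%:R ^+ 3)) (Lambda 3 f).
Proof.
move=> sf; have : uconv (trigP (fcos_half f) (fsin f) (fun k => k%:R `^ 3)) (Lambda 3 f).
  by apply: uconv_Lambda => //; lra.
by under eq_fun do rewrite powR_mulrn//.
Qed.

Lemma torus_int_Lambda3_ge f : smooth_torus f -> (forall s, 0 <= f s) ->
  4^-1 * torus_int (fun s => f s * (f s - fcos f 0) ^+ 2) <=
  torus_int (fun s => f s ^+ 2 * Lambda 3 f s).
Proof.
move=> sf f0; have := torus_int_cube_ge f0 (uconv_fourier sf) (uconv_Lambda3 sf).
by rewrite /fcos_half/= (_ : 2 * (fcos f 0 / 2) = fcos f 0)//; field.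
Qed.

Lemma I1_eq f : smooth_torus f -> 2 * I1 f = torus_int (fun s => f s ^+ 2 * Lambda 3 f s).
Proof.
move=> sf; exact: (torus_int_trilinear_lim (uconv_fourier sf) (uconv_Lambda3 sf)
  (uconv_Lambda_derive1 sf) (uconv_derive1 sf)).
Qed.

Lemma I1_ge0 f : smooth_torus f -> (forall s, 0 <= f s) -> 0 <= I1 f.
Proof.
move=> sf f0; have := torus_int_Lambda3_ge sf f0; rewrite -I1_eq//.
have : 0 <= torus_int (fun s => f s * (f s - fcos f 0) ^+ 2).
  by apply: torus_int_ge0 => s; rewrite mulr_ge0// sqr_ge0.
by move: (torus_int _) (I1 f) => p q; lra.
Qed.

Lemma torus_int_Lambda_half f : smooth_torus f ->
  torus_int (fun s => Lambda 1 (derive1 f) s * derive1 f s) =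
  torus_norm2 (Lambda (3 / 2) f) ^+ 2.
Proof.
move=> sf; rewrite /torus_norm2 sqr_sqrtr; last first.
  by apply: torus_int_ge0 => s; exact: sqr_ge0.
apply: (torus_int_bilinear_lim (v := fun k => k%:R `^ (3 / 2))
  _ (uconv_Lambda_derive1 sf) (uconv_derive1 sf)).
  by move=> k; rewrite -powR_mulrn ?powR_ge0// -powRrM divfK// powR_mulrn.
by apply: uconv_Lambda => //; lra.
Qed.

Lemma derive1_subr f c : derive1 (fun s => f s - c) = derive1 f.
Proof.
apply/funext => s; rewrite /derive1.
suff -> : (fun h : R => h^-1 *: ((f (h + s) - c) - (f s - c))) =
  (fun h => h^-1 *: (f (h + s) - f s)) by [].
by apply/funext => h; congr (_ *: _); ring.
Qed.

Lemma smooth_torus_subr f c : smooth_torus f -> smooth_torus (fun s => f s - c).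
Proof.
move=> [pf df]; split=> [s|[|n] s]; first by rewrite pf.
- by apply: derivableB; [exact: (df 0%N)|exact: derivable_cst].
- by have := df n.+1 s; rewrite /derive1n !iterSr derive1_subr.
Qed.

(** Subtracting a constant changes only the undifferentiated factor. This turns
    nonnegativity of [I1] into the coercive lower bound. *)
Lemma I1_subr f c : smooth_torus f ->
  I1 (fun s => f s - c) = I1 f - c * torus_norm2 (Lambda (3 / 2) f) ^+ 2.
Proof.
move=> sf; rewrite -torus_int_Lambda_half// /I1 derive1_subr.
have bf := smooth_torus_bmeas sf.
have bD := smooth_torus_bmeas (smooth_torus_derive sf).
have bL := uconv_bmeas (bmeas_trigQ _ _ _) (uconv_Lambda_derive1 sf).
rewrite -torus_intZ; last exact: bmeasM.
rewrite -torus_intB; last 2 first.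
- by apply: bmeasM => //; exact: bmeasM.
- by apply: bmeasZ; exact: bmeasM.
by apply: eq_torus_int => s; ring.
Qed.

Lemma torus_int_mul_eq0 f g : bmeas f -> bmeas g -> (forall s, 0 <= f s) ->
  torus_int f = 0 -> torus_int (fun s => f s * g s) = 0.
Proof.
move=> bf bg f0 If; have [_ [M gM]] := bg; have bfg := bmeasM bf bg.
have bound : `|torus_int (fun s => f s * g s)| <= M * torus_int f.
  rewrite -torus_intZ// ler_norml -mulN1r -torus_intZ; last exact: bmeasZ.
  apply/andP; split; apply: le_torus_int => //; try (do ?exact: bmeasZ).
  - by apply: bmeasZ; exact: bmeasZ.
  - move=> s; rewrite mulrA mulN1r mulrC ler_wpM2l//.
    by have := gM s; rewrite ler_norml => /andP[].
  - move=> s; rewrite mulrC ler_wpM2r//.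
    by have := gM s; rewrite ler_norml => /andP[].
by apply/eqP; rewrite -normr_le0 (le_trans bound)// If mulr0.
Qed.

(** A nonnegative function of zero integral has zero Fourier coefficients, and
    Fourier inversion recovers its value at [s]. *)
Lemma ge0_torus_int_eq0 f K s : bmeas f -> (forall t, 0 <= f t) ->
  (forall t, `|f t - f s| <= K * `|sin (2^-1 * (t - s))|) ->
  torus_int f = 0 -> f s = 0.
Proof.
move=> bf f0 fK If; have := fourier_inversion bf fK.
have zero N : trigP (fcos_half f) (fsin f) (fun=> 1) N s = 0.
  rewrite trigP_fourier// torus_int_mul_eq0 ?mulr0//; exact: bmeas_dirichlet.
rewrite (funext zero) => f_lim; apply: cvg_unique f_lim _ => //; exact: cvg_cst.
Qed.

Lemma two_valued_cst f a s t : continuous f -> (forall u, f u = 0 \/ f u = a) ->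
  f s = f t.
Proof.
move=> cf fa; wlog st : s t / s <= t.
  by move=> h; have [/h//|/ltW/h] := leP s t.
have [//|fst] := eqVneq (f s) (f t).
have [c _ fc] : exists2 c, c \in `[s, t]%R & f c = a / 2.
  apply: IVT => //; first exact: continuous_subspaceT.
  by move: fst; case: (fa s) => ->; case: (fa t) => ->; rewrite ?eqxx// => _;
    rewrite /Order.min /Order.max; case: ltP; lra.
have a0 : a = 0 by case: (fa c); rewrite fc; lra.
by case: (fa s) => ->; case: (fa t) => ->; rewrite ?a0.
Qed.

(** The lower bound forces [f (f - a) ^ 2] to vanish, [a] being the mean; a
    continuous function with values in [{0, a}] is constant. *)
Lemma torus_int_Lambda3_eq0 f : smooth_torus f -> (forall s, 0 <= f s) ->
  torus_int (fun s => f s ^+ 2 * Lambda 3 f s) = 0 -> forall s, f s = f 0.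
Proof.
move=> sf f0 I0 s; move: (fcos f 0) (torus_int_Lambda3_ge sf f0) => a.
rewrite I0 => Ih_le; pose h t := f t * (f t - a) ^+ 2.
have bf := smooth_torus_bmeas sf.
have bh : bmeas h.
  by apply: bmeasM => //; apply: bmeasX; apply: bmeasB => //; exact: bmeas_cst.
have h0 t : 0 <= h t by rewrite mulr_ge0// sqr_ge0.
have Ih : torus_int h = 0.
  move: Ih_le; rewrite -/h => Ih_le; apply/eqP.
  by rewrite eq_le torus_int_ge0// andbT; lra.
have [M fM] := smooth_torus_bounded sf; have [K fK] := smooth_torus_chord sf.
apply: (@two_valued_cst _ a); first exact: smooth_torus_continuous.
move=> u; suff /eqP : h u = 0.
  by rewrite mulf_eq0 sqrf_eq0 subr_eq0 => /orP[] /eqP; [left|right].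
apply: (@ge0_torus_int_eq0 _ (K * (3 * M ^+ 2 + 4 * `|a| * M + a ^+ 2))) => // t.
have -> : h t - h u = (f t - f u) *
    (f t * f t + f t * f u + f u * f u - 2 * a * (f t + f u) + a ^+ 2).
  by rewrite /h; ring.
rewrite normrM [leRHS]mulrAC; apply: ler_pM => //.
have sqrM (p q : R) : `|p| <= M -> `|q| <= M -> `|p * q| <= M ^+ 2.
  by move=> pM qM; rewrite normrM expr2 ler_pM.
have tt := sqrM _ _ (fM t) (fM t); have tu := sqrM _ _ (fM t) (fM u).
have uu := sqrM _ _ (fM u) (fM u).
have lin : `|2 * a * (f t + f u)| <= 4 * `|a| * M.
  rewrite !normrM (normr_nat R 2) (_ : 4 * `|a| * M = 2 * `|a| * (M + M)); last by ring.
  by rewrite ler_wpM2l ?mulr_ge0// (le_trans (ler_normD _ _))// lerD.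
move: tt tu uu lin; rewrite !ler_norml.
move: (f t * f t) (f t * f u) (f u * f u) (2 * a * _) (4 * `|a| * M) (M ^+ 2)
  (a ^+ 2) (sqr_ge0 a).
move=> ? ? ? ? ? ? ? ? /andP[? ?] /andP[? ?] /andP[? ?] /andP[? ?].
by apply/andP; split; lra.
Qed.

End fractional_laplacian.

Theorem theorem3p1 (R : realType) (rho : R -> R)
    (rho_smooth : smooth_torus rho) (rho_ge0 : forall s : R, 0 <= rho s) :
  [/\ 0 <= torus_int (fun s => rho s ^+ 2 * Lambda 3 rho s),
      0 <= I1 rho,
      forall kappa : R, 0 < kappa -> (forall s : R, kappa <= rho s) ->
        kappa * torus_norm2 (Lambda (3 / 2) rho) ^+ 2 <= I1 rho,
      torus_int (fun s => rho s ^+ 2 * Lambda 3 rho s) = 0 <->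
        exists c : R, forall s : R, rho s = c
    & I1 rho = 0 <-> exists c : R, forall s : R, rho s = c].
Proof.
have I1E := I1_eq rho_smooth; have I1_pos := I1_ge0 rho_smooth rho_ge0.
have cst_eq0 : (exists c, forall s, rho s = c) -> I1 rho = 0.
  move=> [c rhoc]; have -> : rho = cst c by exact/funext.
  rewrite /I1; under eq_torus_int do rewrite derive1_cst mulr0.
  by rewrite torus_int_cst mul0r.
have eq0_cst : torus_int (fun s => rho s ^+ 2 * Lambda 3 rho s) = 0 ->
    exists c, forall s, rho s = c.
  by move=> I0; exists (rho 0); exact: torus_int_Lambda3_eq0.
split=> //.
- by rewrite -I1E mulr_ge0.
- move=> kappa _ rho_ge; rewrite -subr_ge0 -I1_subr//.
  apply: I1_ge0 => [|s]; [exact: smooth_torus_subr|by rewrite subr_ge0].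
- by split=> [//|/cst_eq0 I10]; rewrite -I1E I10 mulr0.
- by split=> [I10|//]; apply: eq0_cst; rewrite -I1E I10 mulr0.
Qed.
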